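(* Let $k\ge 0$, $1\le p<+\infty$ and $f\in L^p(\mathbb{R},|x|^{2k}dx)$. For every $t>0$, the heat-diffusion integral $G_k(f)(t,x)=\sum_{n=0}^{+\infty}e^{-t(2n+2k+1)}a_n^k(f)h_n^k(x)$ satisfies $$\|G_k(f)(t,\cdot)\|_{k,p}\le(\cosh(2t))^{-(k+\frac12)}\|f\|_{k,p}.$$
   Context: Dunkl--Hermite functions: for $n\ge 0$, $h_n^k(x)=e^{-x^2/2}H_n^k(x)$, where $$H_{2n}^k(x)=(-1)^n\sqrt{\tfrac{n!}{\Gamma(n+k+\frac12)}}\,L_n^{k-\frac12}(x^2),\qquad H_{2n+1}^k(x)=(-1)^n\sqrt{\tfrac{n!}{\Gamma(n+k+\frac32)}}\,x\,L_n^{k+\frac12}(x^2),$$ and $L_n^\alpha(x)=\frac{1}{n!}x^{-\alpha}e^x\frac{d^n}{dx^n}(x^{n+\alpha}e^{-x})$ are the Laguerre polynomials. $L^p(\mathbb{R},|x|^{2k}dx)$ is the space of measurable $f$ on $\mathbb{R}$ with $\|f\|_{k,p}=\left(\int_{\mathbb{R}}|f(x)|^p|x|^{2k}dx\right)^{1/p}<+\infty$. The coefficients are $a_n^k(f)=\int_{\mathbb{R}}f(t)h_n^k(t)|t|^{2k}dt$. *)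

(* Defs.v *)
From HB Require Import structures.
From mathcomp Require Import all_boot all_order all_algebra.
From mathcomp Require Import all_classical all_reals all_analysis.
Set Implicit Arguments.
Unset Strict Implicit.
Unset Printing Implicit Defensive.
Import Order.TTheory GRing.Theory Num.Theory.
Import numFieldNormedType.Exports.
Local Open Scope classical_set_scope.
Local Open Scope ring_scope.

Definition cosh (R : realType) (x : R) : R := (expR x + expR (- x)) / 2.

(* Euler's integral, meaningful for [0 < s] only. *)
Definition Gamma (R : realType) (s : R) : R :=
  \int[lebesgue_measure]_(x in `]0, +oo[) (x `^ (s - 1) * expR (- x)).

Definition rodrigues (R : realType) (n : nat) (a y : R) : R :=
  (n`!%:R)^-1 * y `^ (- a) * expR y
  * derive1n n (fun u : R => u `^ (n%:R + a) * expR (- u)) y.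

(* Rodrigues' formula makes sense for [0 < y] only, where it is a polynomial
   in [y].  The Laguerre polynomial is also evaluated at [0] below, and its
   value there is the limit from the right; negative arguments are not used. *)
Definition laguerre (R : realType) (n : nat) (a y : R) : R :=
  if y == 0 then lim (rodrigues n a u @[u --> (0 : R)^'+])
  else rodrigues n a y.

Definition dunkl_hermite_poly (R : realType) (k : R) (n : nat) (x : R) : R :=
  let m := n./2 in
  if odd n then
    (-1) ^+ m * Num.sqrt (m`!%:R / Gamma (m%:R + k + 3 / 2))
    * x * laguerre m (k + 1 / 2) (x ^+ 2)
  else
    (-1) ^+ m * Num.sqrt (m`!%:R / Gamma (m%:R + k + 1 / 2))
    * laguerre m (k - 1 / 2) (x ^+ 2).

Definition dunkl_hermite (R : realType) (k : R) (n : nat) (x : R) : R :=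
  expR (- x ^+ 2 / 2) * dunkl_hermite_poly k n x.

(* [\bar R]-valued, so that it is defined (possibly [+oo]) for every measurable
   [f]. *)
Definition Lp_norm (R : realType) (k p : R) (f : R -> R) : \bar R :=
  ((\int[lebesgue_measure]_x (`|f x| `^ p * `|x| `^ (2 * k))%:E) `^ p^-1)%E.

Definition in_Lp (R : realType) (k p : R) (f : R -> R) : Prop :=
  measurable_fun setT f /\ (Lp_norm k p f < +oo)%E.

Definition coef_integrand (R : realType) (k : R) (f : R -> R) (n : nat) (u : R)
  : R := f u * dunkl_hermite k n u * `|u| `^ (2 * k).

Definition dunkl_hermite_coef (R : realType) (k : R) (f : R -> R) (n : nat) : R :=
  \int[lebesgue_measure]_u coef_integrand k f n u.

Definition heat_term (R : realType) (k : R) (f : R -> R) (t x : R) (n : nat) : R :=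
  expR (- t * (2 * n%:R + 2 * k + 1))
  * dunkl_hermite_coef k f n * dunkl_hermite k n x.

Definition heat_diffusion (R : realType) (k : R) (f : R -> R) (t x : R) : R :=
  limn (series (heat_term k f t x)).

(* Main.v *)
Require Import Defs.
From HB Require Import structures.
From mathcomp Require Import all_boot all_order all_algebra.
From mathcomp Require Import all_classical all_reals all_analysis.
From mathcomp Require Import measurable_realfun ring lra.
Set Implicit Arguments.
Unset Strict Implicit.
Unset Printing Implicit Defensive.
Import Order.TTheory GRing.Theory Num.Theory.
Import numFieldNormedType.Exports.
Local Open Scope classical_set_scope.
Local Open Scope ring_scope.

(** The heat-diffusion integral is an integral operator whose kernel is known
    in closed form. Put [b = k + 1/2] and [r = expR (- 2 t)], so that
    [expR (- t (2 n + 2 k + 1)) = r^b r^n]. Mehler's formula for the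
    Dunkl-Hermite functions,
    [sum_n r^n h_n(x) h_n(y) = (1 - r^2)^(-b)
       exp (- (x^2 + y^2) / 2 * (1 + r^2) / (1 - r^2)) E_b (x y r / (1 - r^2))],
    where [E_b] is a multiple of the Dunkl kernel ([mehlerE]), yields all that
    is needed:

    - the kernel is nonnegative: the series of [E_b] has nonnegative
      coefficients, and for [z < 0] the function [exp (- 2 z) E_b(z)], which is
      nonincreasing, exceeds its positive value at the origin
      ([dunkl_kernel_mono]);
    - its rows, and by symmetry its columns, have mass at most
      [((1 + r^2) / 2)^(-b)] for the weight [|y|^(2 k)] ([mehler_row_le]), and
      [r^b ((1 + r^2) / 2)^(-b) = cosh (2 t) ^ (-b)] ([heat_mass]);
    - the same monotonicity gives Gaussian decay on the diagonal, so that the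
      arithmetic-geometric mean inequality bounds all partial sums of
      [sum_n r^n |h_n(x) h_n(y)|] by a Gaussian in [y]
      ([mehler_norm_series_le]). Hence the coefficients exist for every [f] in
      [L^p], and the series may be integrated term by term against [f]
      ([mehler_transformE]).

    The [L^p] bound is then Schur's test with equal row and column masses: a
    tangent-line form of Jensen's inequality in [y]
    ([mehler_transform_powR]), followed by Tonelli's theorem
    ([mehler_transform_Lp]).

    Mehler's formula is the Hille-Hardy formula ([hille_hardy]) used twice, with
    parameters [b] for the even and [b + 1] for the odd indices. Its proof rests
    on two facts about [Psi_b(z) = sum_m z^m / (m! Gamma (m + b))]: the generating
    function [sum_n s^n L_n^(b-1)(x) / Gamma (n + b) = exp s Psi_b (- x s)]
    ([lag_generating]), and the Laplace transform of [s^(n+b-1) Psi_b (- x s)],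
    which is again a Laguerre polynomial ([lag_laplace]). The Laguerre
    polynomials, given by Rodrigues' formula, are put into explicit form by
    induction on the order of the derivative ([rodrigues_derive]). *)

(** * Differentiation rules *)

Section Derivatives.
Context {R : realType}.
Implicit Types (F G : R -> R) (f g x : R).

Lemma is_derive_add F G f g x : is_derive x (1 : R) F f ->
  is_derive x (1 : R) G g -> is_derive x (1 : R) (fun y => F y + G y) (f + g).
Proof. by move=> dF dG; apply: is_deriveD. Qed.

Lemma is_derive_mul F G f g x : is_derive x (1 : R) F f ->
  is_derive x (1 : R) G g ->
  is_derive x (1 : R) (fun y => F y * G y) (f * G x + F x * g).
Proof.
move=> dF dG; have := is_deriveM dF dG.
by rewrite /GRing.scale/= addrC [G x * f]mulrC.
Qed.

Lemma is_derive_scale F f c x : is_derive x (1 : R) F f ->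
  is_derive x (1 : R) (fun y => c * F y) (c * f).
Proof. by move=> dF; exact: is_deriveZ. Qed.

Lemma is_derive_exprn n x : is_derive x (1 : R) (fun y : R => y ^+ n)
  (n%:R * x ^+ n.-1).
Proof.
have := is_deriveX n (is_derive_id x (1 : R)).
rewrite /GRing.scale/= mulr1.
have -> // : (fun y : R => y ^+ n) = id ^+ n.
by apply/funext => y; rewrite fctE.
Qed.

Lemma is_derive_expRM c x :
  is_derive x (1 : R) (fun y : R => expR (c * y)) (c * expR (c * x)).
Proof.
have := is_derive1_comp (is_derive_expR (c * x))
  (is_derive_scale c (is_derive_id x (1 : R))).
by rewrite mulr1 mulrC.
Qed.

End Derivatives.

(** * Integrals over the positive half-line *)

Section HalfLine.
Context {R : realType}.
Implicit Types (F f g : R -> R) (a b s x : R).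

Notation mu := (@lebesgue_measure R).
Notation pos := (`]0%R, +oo[%classic : set R).

Lemma continuous_pos_within f a b : 0 < a ->
  (forall x, 0 < x -> {for x, continuous f}) -> {within `[a, b], continuous f}.
Proof.
move=> a0 cf; apply: continuous_in_subspaceT => x.
rewrite inE/= in_itv/= => /andP[ax _]; apply: cf; exact: lt_le_trans ax.
Qed.

Lemma continuous_pos_integrable f a b : 0 < a ->
  (forall x, 0 < x -> {for x, continuous f}) ->
  mu.-integrable `[a, b] (EFin \o f).
Proof.
move=> a0 cf; apply: continuous_compact_integrable; first exact: segment_compact.
exact: continuous_pos_within.
Qed.

Lemma derivable_pos_LRcontinuous F f a b : 0 < a -> a < b ->
  (forall x, 0 < x -> is_derive x (1 : R) F (f x)) ->
  derivable_oo_LRcontinuous F a b.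
Proof.
move=> a0 ab dF.
have cF x : 0 < x -> {for x, continuous F}.
  move=> x0; apply: differentiable_continuous; apply/derivable1_diffP.
  by have [] := dF _ x0.
split.
- move=> x; rewrite in_itv/= => /andP[ax _].
  by have [] := dF _ (lt_trans a0 ax).
- by apply: cvg_at_right_filter; apply: cF.
- by apply: cvg_at_left_filter; apply: cF; exact: lt_trans ab.
Qed.

Lemma integral_pos_FTC2 F f a b : 0 < a -> a < b ->
  (forall x, 0 < x -> is_derive x (1 : R) F (f x)) ->
  (forall x, 0 < x -> {for x, continuous f}) ->
  (\int[mu]_(x in `[a, b]) (f x)%:E = (F b)%:E - (F a)%:E)%E.
Proof.
move=> a0 ab dF cf; apply: continuous_FTC2 => //.
- exact: continuous_pos_within.
- exact: derivable_pos_LRcontinuous dF.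
- move=> x; rewrite in_itv/= => /andP[ax _].
  by rewrite derive1E; have [_ ->] := dF _ (lt_trans a0 ax).
Qed.

(** Exhausting the half-line by compact intervals keeps a possible
    singularity at the origin out of the fundamental theorem of calculus. *)
Lemma cvg_integral_exhaustion (u v : nat -> R) f :
  (forall n, 0 < u n) ->
  (forall m n, (m <= n)%N -> u n <= u m /\ v m <= v n) ->
  u n @[n --> \oo] --> 0 -> v n @[n --> \oo] --> +oo ->
  measurable_fun [set: R] f -> (forall x, 0 < x -> 0 <= f x) ->
  (\int[mu]_(x in `[u n, v n]) (f x)%:E @[n --> \oo] -->
   \int[mu]_(x in pos) (f x)%:E)%E.
Proof.
move=> u0 uv cu cv mf f0.
have -> : pos = \bigcup_n `[u n, v n]%classic.
  rewrite eqEsubset; split=> x /=.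
    rewrite in_itv/= andbT => x0.
    have : \forall n \near \oo, u n <= x /\ x <= v n.
      near=> n; split; near: n.
        by move/cvgr0_norm_le : cu => /(_ _ x0); apply: filterS => n;
          exact/le_trans/ler_norm.
      by move/cvgryPge : cv; exact.
    move=> [N _ /(_ _ (leqnn N)) [uN vN]].
    by exists N => //=; rewrite in_itv/= uN vN.
  move=> [n _] /=; rewrite !in_itv/= andbT => /andP[+ _].
  exact/lt_le_trans.
apply: ge0_nondecreasing_set_cvg_integral => //.
- move=> m n mn; apply/subsetPset => x /=; rewrite !in_itv/=.
  have [um vm] := uv _ _ mn.
  by move=> /andP[mx xm]; rewrite (le_trans um mx) (le_trans xm vm).
- by move=> n; apply/measurable_EFinP; exact: measurable_funS mf.
- move=> n x /=; rewrite in_itv/= => /andP[ux _].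
  by rewrite lee_fin f0// (lt_le_trans _ ux).
Unshelve. all: by end_near. Qed.

(** The exhaustion starts at [1/2, 2], so that all its intervals have positive
    length. *)
Definition lo (n : nat) : R := n.+2%:R^-1.
Definition hi (n : nat) : R := n.+2%:R.

Lemma lo_gt0 n : 0 < lo n. Proof. by rewrite invr_gt0. Qed.

Lemma lo_lt_hi n : lo n < hi n.
Proof.
rewrite /lo /hi; apply: (@lt_trans _ _ 1); last by rewrite ltr1n.
by rewrite invf_lt1// ltr1n.
Qed.

Lemma cvg_lo : lo n @[n --> \oo] --> 0.
Proof.
have := @cvg_harmonic R; rewrite -(cvg_shiftS (@harmonic R)).
exact.
Qed.

Lemma cvg_hi : hi n @[n --> \oo] --> +oo.
Proof.
have h := @cvgr_idn R.
rewrite -(cvg_shiftS (fun n => n%:R : R)) -(cvg_shiftS (fun n => n.+1%:R : R)) in h.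
exact: h.
Qed.

Lemma lo_hi_mono m n : (m <= n)%N -> lo n <= lo m /\ hi m <= hi n.
Proof. by move=> mn; rewrite /lo /hi lef_pV2 ?posrE// !ler_nat !ltnS. Qed.

Lemma cvg_integral_lohi f :
  measurable_fun [set: R] f -> (forall x, 0 < x -> 0 <= f x) ->
  (\int[mu]_(x in `[lo n, hi n]) (f x)%:E @[n --> \oo] -->
   \int[mu]_(x in pos) (f x)%:E)%E.
Proof.
exact: (cvg_integral_exhaustion lo_gt0 lo_hi_mono cvg_lo cvg_hi).
Qed.

(** The integrand may be singular at the origin, as [s^(b-1)] is for [b < 1]:
    the substitution is made on compact intervals, and both sides pass to the
    limit. *)
Lemma integral_pos_subst_monomial (l : R) (m : nat) f : 0 < l ->
  (forall x, 0 < x -> {for x, continuous f}) ->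
  measurable_fun [set: R] f -> (forall x, 0 < x -> 0 <= f x) ->
  (\int[mu]_(s in pos) (f s)%:E =
   \int[mu]_(y in pos)
     (f (l * y ^+ m.+1) * (l * m.+1%:R * y ^+ m))%:E)%E.
Proof.
move=> l0 cf mf f0.
pose F (y : R) : R := l * y ^+ m.+1.
have dF y : is_derive y (1 : R) F (l * m.+1%:R * y ^+ m).
  by rewrite /F -mulrA; exact/is_derive_scale/(is_derive_exprn m.+1).
have dFE : F^`()%classic = fun y => l * m.+1%:R * y ^+ m.
  by apply/funext => y; rewrite derive1E; have [_ ->] := dF y.
have cF' : continuous F^`()%classic.
  rewrite dFE => y; apply: cvgM; first exact: cvg_cst.
  exact: exprn_continuous.
have Fmono x y : 0 < x -> x < y -> F x < F y.
  by move=> x0 xy; rewrite /F ltr_pM2l// ltrXn2r// ltW.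
have e n : (\int[mu]_(x in `[F (lo n), F (hi n)]) (f x)%:E =
   \int[mu]_(y in `[lo n, hi n]) (f (F y) * (l * m.+1%:R * y ^+ m))%:E)%E.
  rewrite integration_by_substitution_increasing ?dFE//.
  - exact/ltW/lo_lt_hi.
  - move=> x y; rewrite !in_itv/= => /andP[lx _] _; apply: Fmono.
    exact: lt_le_trans (lo_gt0 n) lx.
  - by move=> y _; rewrite -dFE; apply: cF'.
  - rewrite -dFE; apply/cvg_ex; exists (F^`()%classic (lo n)).
    by apply: cvg_at_right_filter; apply: cF'.
  - rewrite -dFE; apply/cvg_ex; exists (F^`()%classic (hi n)).
    by apply: cvg_at_left_filter; apply: cF'.
  - apply: (@derivable_pos_LRcontinuous F (fun y => l * m.+1%:R * y ^+ m)) => //.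
      exact: lo_gt0.
    exact: lo_lt_hi.
  - apply: continuous_pos_within => //.
    by rewrite /F mulr_gt0// exprn_gt0// lo_gt0.
have F0 : F (lo n) @[n --> \oo] --> 0.
  have -> : 0 = F 0 by rewrite /F expr0n/= mulr0.
  apply: continuous_cvg; last exact: cvg_lo.
  by apply: differentiable_continuous; apply/derivable1_diffP; have [] := dF 0.
have Fy : F (hi n) @[n --> \oo] --> +oo.
  apply/cvgryPge => A.
  have /cvgryPge/(_ (A / l)) := cvg_hi.
  apply: filterS => n; rewrite ler_pdivrMr// => /le_trans; apply.
  rewrite mulrC /F ler_pM2l// ler_eXnr// /hi ler1n//.
have mF : measurable_fun [set: R] F.
  by apply: continuous_measurable_fun => y; apply: differentiable_continuous;
   apply/derivable1_diffP; have [] := dF y.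
have h1 : (\int[mu]_(x in `[F (lo n), F (hi n)]) (f x)%:E @[n --> \oo] -->
    \int[mu]_(x in pos) (f x)%:E)%E.
  apply: (@cvg_integral_exhaustion (F \o lo) (F \o hi)) => //=.
    by move=> n; rewrite /F mulr_gt0// exprn_gt0// lo_gt0.
  move=> p q /lo_hi_mono[l1 h1]; rewrite /F !ler_pM2l//.
  by split; rewrite lerXn2r ?nnegrE// ltW// ?lo_gt0// /hi ltr0n.
have h2 : (\int[mu]_(y in `[lo n, hi n]) (f (F y) * (l * m.+1%:R * y ^+ m))%:E
   @[n --> \oo] --> \int[mu]_(y in pos)
     (f (F y) * (l * m.+1%:R * y ^+ m))%:E)%E.
  apply: cvg_integral_lohi => [|y y0].
    apply: measurable_funM; first exact: measurableT_comp.
    by rewrite -dFE; exact: continuous_measurable_fun.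
  rewrite mulr_ge0//; first by apply: f0; rewrite /F mulr_gt0// exprn_gt0.
  by rewrite mulr_ge0// ?exprn_ge0// ?mulr_ge0// ltW.
rewrite -(cvg_lim _ h1)// -(cvg_lim _ h2)//.
by congr (limn _); apply/funext => n; exact: e.
Qed.

End HalfLine.

(** * The Gamma function *)

Section GammaFunction.
Context {R : realType}.
Implicit Types (a b c l s x : R).

Notation mu := (@lebesgue_measure R).
Notation pos := (`]0%R, +oo[%classic : set R).

Lemma powRD_gt0 x a b : 0 < x -> x `^ (a + b) = x `^ a * x `^ b.
Proof. by move=> x0; rewrite powRD// (gt_eqF x0) implybT. Qed.

Definition laplace_power c l x := x `^ (c - 1) * expR (- l * x).

Lemma laplace_power_ge0 c l x : 0 <= laplace_power c l x.
Proof. by rewrite mulr_ge0 ?powR_ge0 ?expR_ge0. Qed.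

Lemma is_derive_laplace_power c l x : 0 < x ->
  is_derive x (1 : R) (laplace_power c l)
    ((c - 1) * laplace_power (c - 1) l x - l * laplace_power c l x).
Proof.
move=> x0; apply: (is_derive_eq (is_derive_mul (is_derive1_powR _ x0)
  (is_derive_expRM (- l) x))).
by rewrite /laplace_power; ring.
Qed.

Lemma continuous_laplace_power c l x : 0 < x ->
  {for x, continuous (laplace_power c l)}.
Proof.
move=> x0; apply: differentiable_continuous; apply/derivable1_diffP.
by have [] := is_derive_laplace_power c l x0.
Qed.

Lemma measurable_laplace_power c l : measurable_fun [set: R] (laplace_power c l).
Proof.
apply: measurable_funM; first exact: measurable_powR.
by apply: measurableT_comp => //; exact: measurable_funM.
Qed.

(** Euler's integral as an extended real: its functional equation comes before
    its finiteness, which is deduced from it. *)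
Definition gammaE s : \bar R := (\int[mu]_(x in pos) (laplace_power s 1 x)%:E)%E.

Lemma GammaE s : Gamma s = fine (gammaE s).
Proof.
rewrite /Gamma /Rintegral /gammaE; congr fine; apply: eq_integral => x _.
by rewrite /laplace_power mulN1r.
Qed.

Lemma gammaE_ge0 s : (0 <= gammaE s)%E.
Proof. by apply: integral_ge0 => x _; rewrite lee_fin laplace_power_ge0. Qed.

Lemma cvg_laplace_power_hi s : laplace_power s 1 (hi n) @[n --> \oo] --> 0.
Proof.
have [N sN] : exists N : nat, s - 1 <= N%:R.
  by exists (Num.bound `|s - 1|); apply/(le_trans (ler_norm _))/ltW/archi_boundP.
apply: (@squeeze_cvgr _ _ _ _ (fun=> 0) (fun n => N.+1`!%:R * lo n)).
- near=> n; rewrite laplace_power_ge0/= /laplace_power mulN1r expRN.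
  have h0 : 0 < hi n :> R by rewrite /hi.
  have h1 : 1 <= hi n :> R by rewrite /hi ler1n.
  rewrite ler_pdivrMr ?expR_gt0//.
  have := expR_ge1Dxn N (ltW h0).
  move=> h; apply: (@le_trans _ _ (hi n ^+ N)).
    by rewrite -powR_mulrn ?(ltW h0)// ler_powR.
  have f0 : 0 < N.+1`!%:R :> R by rewrite ltr0n fact_gt0.
  apply: (@le_trans _ _ (N.+1`!%:R * lo n * (hi n ^+ N.+1 / N.+1`!%:R))).
    rewrite exprS /lo -/(hi n) le_eqVlt; apply/orP; left; apply/eqP.
    by field; rewrite !gt_eqF.
  by rewrite ler_pM2l ?mulr_gt0 ?lo_gt0// (le_trans _ h)// lerDr.
- exact: cvg_cst.
- rewrite -[X in _ --> X](mulr0 N.+1`!%:R); apply: cvgMr; exact: cvg_lo.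
Unshelve. all: by end_near. Qed.

Lemma cvg_laplace_power_lo s : 0 < s -> laplace_power (s + 1) 1 (lo n) @[n --> \oo] --> 0.
Proof.
move=> s0; apply: (@squeeze_cvgr _ _ _ _ (fun=> 0) (fun n => lo n `^ s)).
- near=> n; rewrite laplace_power_ge0/= /laplace_power addrK.
  by rewrite ler_piMr ?powR_ge0// expR_le1 mulN1r oppr_le0 ltW// lo_gt0.
- exact: cvg_cst.
- have lo0 : (lo n : R) @[n --> \oo] --> 0^'+.
    move=> A [e /= e0 eA].
    have /cvgr0_norm_lt/(_ _ e0) := @cvg_lo R; apply: filterS => n ne.
    by apply: eA => /=; rewrite ?lo_gt0// sub0r normrN.
  exact: (cvg_comp _ _ lo0 (powR_cvg0 s0)).
Unshelve. all: by end_near. Qed.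

(** Integrating the derivative of [x^s e^{-x}] gives nothing in the limit; both
    sides may still be infinite at this point. *)
Lemma gammaE_S s : 0 < s -> (gammaE (s + 1) = s%:E * gammaE s)%E.
Proof.
move=> s0.
pose A n : \bar R := (\int[mu]_(x in `[lo n, hi n]) (laplace_power (s + 1) 1 x)%:E)%E.
pose B n : \bar R := (\int[mu]_(x in `[lo n, hi n]) (s * laplace_power s 1 x)%:E)%E.
pose d n : R := laplace_power (s + 1) 1 (lo n) - laplace_power (s + 1) 1 (hi n).
have cA : (A n @[n --> \oo] --> gammaE (s + 1))%E.
  apply: cvg_integral_lohi; first exact: measurable_laplace_power.
  by move=> x _; exact: laplace_power_ge0.
have cB : (B n @[n --> \oo] --> s%:E * gammaE s)%E.
  rewrite /gammaE -ge0_integralZl_EFin//=; last 3 first.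
  - by move=> x _; rewrite lee_fin laplace_power_ge0.
  - apply/measurable_EFinP; apply: measurable_funS (measurable_laplace_power s 1) => //.
  - exact: ltW.
  apply: cvg_integral_lohi; first by apply: measurable_funM => //; exact: measurable_laplace_power.
  by move=> x _; rewrite mulr_ge0 ?laplace_power_ge0// ltW.
have cd : (d n @[n --> \oo] --> 0).
  rewrite -(subr0 0); apply: cvgB; first exact: cvg_laplace_power_lo.
  exact: cvg_laplace_power_hi.
have iA n : mu.-integrable `[lo n, hi n] (EFin \o laplace_power (s + 1) 1).
  by apply: continuous_pos_integrable; [exact: lo_gt0|exact: continuous_laplace_power].
have cs x : 0 < x -> {for x, continuous (fun x => s * laplace_power s 1 x)}.
  by move=> x0; apply: cvgMr; exact: continuous_laplace_power.
have iB n : mu.-integrable `[lo n, hi n] (EFin \o (fun x => s * laplace_power s 1 x)).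
  by apply: continuous_pos_integrable; [exact: lo_gt0|exact: cs].
have AB n : (A n = B n + (d n)%:E)%E.
  have dF x : 0 < x -> is_derive x (1 : R) (fun x => - laplace_power (s + 1) 1 x)
      (laplace_power (s + 1) 1 x - s * laplace_power s 1 x).
    move=> x0.
    have -> : (fun x => - laplace_power (s + 1) 1 x) = (fun x => -1 * laplace_power (s + 1) 1 x).
      by apply/funext => y; rewrite mulN1r.
    apply: (is_derive_eq (is_derive_scale (-1) (is_derive_laplace_power (s + 1) 1 x0))).
    by rewrite addrK; ring.
  have cf x : 0 < x ->
      {for x, continuous (fun x => laplace_power (s + 1) 1 x - s * laplace_power s 1 x)}.
    by move=> x0; apply: cvgB; [exact: continuous_laplace_power|exact: cs].
  have := integral_pos_FTC2 (lo_gt0 n) (lo_lt_hi n) dF cf.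
  rewrite -EFinB opprK (addrC (- _)) -/(d n) => <-.
  have -> : (\int[mu]_(x in `[lo n, hi n])
    (laplace_power (s + 1) 1 x - s * laplace_power s 1 x)%:E = A n - B n)%E.
    by rewrite /A /B -integralB//=.
  by rewrite addeC subeK//; exact: integrable_fin_num (iB n).
have : ((B n + (d n)%:E)%E @[n --> \oo] --> (s%:E * gammaE s + 0%:E)%E).
  apply: cvgeD => //; last by apply: cvg_EFin => //; exact: nearW.
  by rewrite fin_num_adde_defl.
rewrite adde0 => cBd.
rewrite -(cvg_lim _ cA)// -(cvg_lim _ cBd)//.
by congr (limn _); apply/funext => n; exact: AB.
Qed.

Lemma gammaE1_lty : (gammaE 1 < +oo)%E.
Proof.
suff : (gammaE 1 <= 1)%E by move=> /le_lt_trans; apply; rewrite ltry.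
have cA : ((\int[mu]_(x in `[lo n, hi n]) (laplace_power 1 1 x)%:E)%E @[n --> \oo] --> gammaE 1)%E.
  apply: cvg_integral_lohi; first exact: measurable_laplace_power.
  by move=> x _; exact: laplace_power_ge0.
rewrite -(cvg_lim _ cA)//; apply: lime_le; first by apply/cvg_ex; eexists; exact: cA.
near=> n.
have dF x : 0 < x -> is_derive x (1 : R) (fun x => - laplace_power 1 1 x)
    (laplace_power 1 1 x).
  move=> x0.
  have -> : (fun x => - laplace_power 1 1 x) = (fun x => -1 * laplace_power 1 1 x).
    by apply/funext => y; rewrite mulN1r.
  apply: (is_derive_eq (is_derive_scale (-1) (is_derive_laplace_power 1 1 x0))).
  by rewrite subrr; ring.
have -> := integral_pos_FTC2 (lo_gt0 n) (lo_lt_hi n) dF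
  (fun x => @continuous_laplace_power 1 1 x).
rewrite -EFinB lee_fin opprK addrC; apply: (@le_trans _ _ (laplace_power 1 1 (lo n))).
  by rewrite lerBlDr lerDl laplace_power_ge0.
by rewrite /laplace_power subrr powRr0 mul1r expR_le1 mulN1r oppr_le0 ltW// lo_gt0.
Unshelve. all: by end_near. Qed.

Lemma gammaE_nat_lty n : (gammaE n.+1%:R < +oo)%E.
Proof.
elim: n => [|n ih]; first exact: gammaE1_lty.
rewrite -natr1 gammaE_S//; exact: lte_mul_pinfty.
Qed.

(** Above [1] the integrand is dominated by those at [1] and at a larger
    integer; below [1] the functional equation shifts the argument. *)
Lemma gammaE_lty s : 0 < s -> (gammaE s < +oo)%E.
Proof.
have ge1 (u : R) : 1 <= u -> (gammaE u < +oo)%E.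
  move=> u1.
  have [N uN] : exists N : nat, u - 1 <= N%:R.
    by exists (Num.bound (u - 1)); apply: ltW; rewrite archi_boundP// subr_ge0.
  apply: (@le_lt_trans _ _ (\int[mu]_(x in pos)
    ((laplace_power 1 1 x)%:E + (laplace_power N.+1%:R 1 x)%:E))%E).
    apply: ge0_le_integral => //=.
    - by move=> x _; rewrite lee_fin laplace_power_ge0.
    - apply/measurable_EFinP; apply: measurable_funS (measurable_laplace_power u 1) => //.
    - apply: emeasurable_funD; apply/measurable_EFinP.
        exact: measurable_funS (measurable_laplace_power 1 1).
      exact: measurable_funS (measurable_laplace_power _ 1).
    - move=> x; rewrite in_itv/= andbT => x0; rewrite -EFinD lee_fin /laplace_power.
      rewrite -mulrDl ler_wpM2r ?expR_ge0// subrr powRr0 -natr1 addrK.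
      have [x1|x1] := leP 1 x.
        by apply: (le_trans (ler_powR x1 uN)); rewrite lerDr.
      apply: (@le_trans _ _ 1); last by rewrite lerDl powR_ge0.
      have u0 : 0 <= u - 1 by rewrite subr_ge0.
      by have := ger_powR _ u0 => /(_ x); rewrite powRr0 x0 (ltW x1); apply.
  rewrite ge0_integralD//=; last 4 first.
  - by move=> x _; rewrite lee_fin laplace_power_ge0.
  - by apply/measurable_EFinP; exact: measurable_funS (measurable_laplace_power 1 1).
  - by move=> x _; rewrite lee_fin laplace_power_ge0.
  - by apply/measurable_EFinP; exact: measurable_funS (measurable_laplace_power _ 1).
  by rewrite lte_add_pinfty ?gammaE1_lty ?gammaE_nat_lty.
move=> s0; have := ge1 (s + 1); rewrite lerDr gammaE_S// => /(_ (ltW s0)).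
case: (gammaE s) (gammaE_ge0 s) => [r _ _|_|//]; first by rewrite ltry.
by rewrite mulry gtr0_sg// mul1e.
Qed.

Lemma gammaE_fin_num s : 0 < s -> gammaE s \is a fin_num.
Proof. by move=> s0; rewrite ge0_fin_numE ?gammaE_ge0 ?gammaE_lty. Qed.

Lemma gammaE_EFin s : 0 < s -> gammaE s = (Gamma s)%:E.
Proof. by move=> s0; rewrite GammaE fineK ?gammaE_fin_num. Qed.

Lemma GammaS s : 0 < s -> Gamma (s + 1) = s * Gamma s.
Proof. by move=> s0; rewrite !GammaE gammaE_S// fineM ?gammaE_fin_num. Qed.

(** Superexponential growth, from the part of Euler's integral over
    [[K, K + 1]]. *)
Lemma Gamma_ge_geometric b (K : R) (m : nat) : 0 < b -> 1 <= K ->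
  K ^+ m * (expR (- (K + 1)) / (K + 1)) <= Gamma (m%:R + b).
Proof.
move=> b0 K1; have K0 : 0 < K by exact: lt_le_trans K1.
have mb0 : 0 < m%:R + b by rewrite ltr_wpDl.
rewrite -lee_fin -gammaE_EFin//.
set c := (X in X%:E).
have c0 : 0 <= c by rewrite mulr_ge0 ?exprn_ge0 ?divr_ge0 ?expR_ge0// ?addr_ge0// ltW.
apply: (@le_trans _ _ (\int[mu]_(x in `[K, (K + 1)%R]) c%:E)%E).
  rewrite integral_cst//= lebesgue_measure_itv/= lte_fin ltrDl ltr01.
  by rewrite -EFinB (addrC K) addrK mule1.
apply: (@le_trans _ _ (\int[mu]_(x in `[K, (K + 1)%R]) (laplace_power (m%:R + b) 1 x)%:E)%E).
  apply: ge0_le_integral => //=.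
  - by apply/measurable_EFinP; exact: measurable_funS (measurable_laplace_power _ 1).
  - move=> x; rewrite in_itv/= => /andP[Kx xK]; rewrite lee_fin.
    have x0 : 0 < x by exact: lt_le_trans Kx.
    rewrite /c /laplace_power -addrA powRD_gt0// powR_mulrn ?(ltW x0)//.
    rewrite mulrAC -mulrA ler_pM ?exprn_ge0 ?(ltW K0)//.
    - by rewrite divr_ge0 ?expR_ge0// addr_ge0// ltW.
    - by rewrite lerXn2r ?nnegrE ?(ltW x0) ?(ltW K0).
    rewrite ler_pM ?expR_ge0 ?invr_ge0 ?addr_ge0 ?(ltW K0)//.
      by rewrite ler_expR mulN1r lerN2.
    apply: (@le_trans _ _ (x `^ (-1))); last by rewrite ler_powR ?(le_trans K1)// lerDr ltW.
    by rewrite powR_inv1 ?(ltW x0)// lef_pV2 ?posrE// addr_gt0.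
apply: ge0_subset_integral => //=.
- by apply/measurable_EFinP; exact: measurable_funS (measurable_laplace_power _ 1).
- by move=> x _; rewrite lee_fin laplace_power_ge0.
- move=> x /=; rewrite !in_itv/= andbT => /andP[+ _]; exact: lt_le_trans.
Qed.

Lemma Gamma_gt0 s : 0 < s -> 0 < Gamma s.
Proof.
move=> s0; have := @Gamma_ge_geometric s 1 0 s0 (lexx _).
rewrite expr0 mul1r add0r; apply: lt_le_trans.
by rewrite divr_gt0 ?expR_gt0// addr_gt0.
Qed.

Lemma integral_laplace_power c l : 0 < c -> 0 < l ->
  (\int[mu]_(s in pos) (laplace_power c l s)%:E = (Gamma c * l `^ (- c))%:E)%E.
Proof.
move=> c0 l0.
have := @integral_pos_subst_monomial _ l 0 (laplace_power c 1) l0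
  (fun x => @continuous_laplace_power c 1 x) (measurable_laplace_power c 1)
  (fun x _ => laplace_power_ge0 c 1 x).
rewrite -/(gammaE c) gammaE_EFin// => e.
rewrite EFinM muleC e -ge0_integralZl_EFin//=; last 3 first.
- move=> x; rewrite in_itv/= andbT => x0.
  by rewrite lee_fin !mulr_ge0// ?powR_ge0 ?expR_ge0// ltW.
- apply/measurable_EFinP; apply: (@measurable_funS _ _ _ _ setT) => //.
  apply: measurable_funM => //; apply: measurableT_comp => //.
    exact: measurable_laplace_power.
  exact: measurable_funM.
- exact: powR_ge0.
apply: eq_integral => x; rewrite inE/= in_itv/= andbT => x0; rewrite -EFinM; congr EFin.
rewrite /laplace_power !expr1 expr0 !mulr1 powRM ?(ltW x0) ?(ltW l0)// mulN1r -mulNr.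
rewrite (powRD_gt0 c (-1) l0) !powRN powRr1 ?(ltW l0)//.
by field; rewrite !gt_eqF// powR_gt0.
Qed.

Lemma integrable_laplace_power c l : 0 < c -> 0 < l ->
  mu.-integrable pos (EFin \o laplace_power c l).
Proof.
move=> c0 l0; apply/integrableP; split.
  by apply/measurable_EFinP; exact: measurable_funS (measurable_laplace_power _ _).
under eq_integral do rewrite gee0_abs ?lee_fin ?laplace_power_ge0//.
by rewrite integral_laplace_power// ltry.
Qed.

Lemma integral_gaussian_moment c l : 0 < c -> 0 < l ->
  (\int[mu]_(y in pos) (y `^ (2 * c - 1) * expR (- l * y ^+ 2))%:E =
   (2^-1 * Gamma c * l `^ (- c))%:E)%E.
Proof.
move=> c0 l0.
have := @integral_pos_subst_monomial _ 1 1 (laplace_power c l) ltr01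
  (fun x => @continuous_laplace_power c l x) (measurable_laplace_power c l)
  (fun x _ => laplace_power_ge0 c l x).
rewrite integral_laplace_power// => e.
rewrite -mulrA EFinM e -ge0_integralZl_EFin//=.
- apply: eq_integral => x; rewrite inE/= in_itv/= andbT => x0; rewrite -EFinM; congr EFin.
  rewrite !mul1r /laplace_power expr1.
  have -> : 2 * c - 1 = (c - 1) + (c - 1) + 1 by ring.
  rewrite powRD_gt0// powRr1 ?(ltW x0)//.
  rewrite powRD_gt0// expr2 powRM ?(ltW x0)//.
  by field.
- move=> x; rewrite in_itv/= andbT => x0.
  by rewrite lee_fin !mulr_ge0// ?powR_ge0 ?expR_ge0// exprn_ge0// ltW.
- apply/measurable_EFinP; apply: (@measurable_funS _ _ _ _ setT) => //.
  apply: measurable_funM => //.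
    apply: measurableT_comp; first exact: measurable_laplace_power.
    by apply: measurable_funM => //; exact: measurable_funX.
  by apply: measurable_funM => //; exact: measurable_funX.
Qed.

End GammaFunction.

#[local] Opaque Gamma.

(** * Series of real numbers *)

Section Series.
Context {R : realType}.
Implicit Types (u v : nat -> R).

Lemma cvg_half : n./2 @[n --> \oo] --> \oo.
Proof.
apply/cvgnyPge => A; near=> n.
rewrite -(doubleK A); apply: half_leq.
by near: n; exact: nbhs_infty_ge.
Unshelve. all: by end_near. Qed.

Lemma nondecreasing_series_ge0 u : (forall n, 0 <= u n) ->
  nondecreasing_seq (series u).
Proof. by move=> u0; apply: nondecreasing_series => n _ _; exact: u0. Qed.

Lemma series_le_limn u N : (forall n, 0 <= u n) -> cvgn (series u) ->
  series u N <= limn (series u).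
Proof. by move=> u0 cu; apply: nondecreasing_cvgn_le => //; exact: nondecreasing_series_ge0. Qed.

Lemma series_ge0_cvg_bound u (M : R) : (forall n, 0 <= u n) ->
  (forall n, series u n <= M) -> cvgn (series u).
Proof.
move=> u0 uM; apply: nondecreasing_is_cvgn; first exact: nondecreasing_series_ge0.
by exists M => _ [n _ <-].
Qed.

Lemma ler_norm_series u N : `|series u N| <= series (fun n => `|u n|) N.
Proof. exact: ler_norm_sum. Qed.

Lemma norm_series_cvg u : cvgn (series (fun n => `|u n|)) -> cvgn (series u).
Proof. by move=> cu; apply: normed_cvg. Qed.

Lemma seriesMl (c : R) u : series (fun n => c * u n) = (fun N => c * series u N).
Proof. by apply/funext => N; rewrite /series/= mulr_sumr. Qed.

Lemma cvg_seriesMl (c l : R) u : series u @ \oo --> l ->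
  series (fun n => c * u n) @ \oo --> c * l.
Proof. by move=> cu; rewrite seriesMl; exact: cvgMr. Qed.

Lemma cvg_series_unique u (l1 l2 : R) :
  series u @ \oo --> l1 -> series u @ \oo --> l2 -> l1 = l2.
Proof. by move=> c1 c2; rewrite -(cvg_lim _ c1)// -(cvg_lim _ c2). Qed.

Lemma series_even_odd u N :
  series u N = series (fun m => u m.*2) (uphalf N) + series (fun m => u m.*2.+1) N./2.
Proof.
elim: N => [|N ih]; first by rewrite /series/= !big_geq// addr0.
have -> : uphalf N.+1 = N./2.+1 by [].
have -> : N.+1./2 = uphalf N by [].
rewrite seriesSr ih uphalf_half.
have -> : u N = u (odd N + N./2.*2)%N by rewrite odd_double_half.
case: (odd N) => /=; last by rewrite !add0n seriesSr addrAC.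
by rewrite !add1n 2!seriesSr addrA.
Qed.

Definition cauchy_prod u v n : R := \sum_(i < n.+1) u i * v (n - i)%N.

Lemma series_triangle (f : nat -> nat -> R) N :
  \sum_(0 <= n < N) \sum_(i < n.+1) f i (n - i)%N =
  \sum_(0 <= i < N) \sum_(0 <= j < N - i) f i j.
Proof.
elim: N => [|N ih]; first by rewrite !big_geq.
rewrite big_nat_recr//= ih [RHS]big_nat_recr//= subSnn big_nat1.
rewrite big_ord_recr/= subnn addrA; congr (_ + _).
rewrite big_mkord -big_split/= [RHS]big_mkord.
apply: eq_bigr => i _.
by rewrite subSn; [rewrite big_nat_recr|exact: ltnW].
Qed.

Section NonNeg.
Variables (u v : nat -> R).
Hypotheses (u0 : forall n, 0 <= u n) (v0 : forall n, 0 <= v n).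

Lemma cauchy_prod_series_le N :
  series (cauchy_prod u v) N <= series u N * series v N.
Proof.
rewrite /series/= /cauchy_prod (series_triangle (fun i j => u i * v j)) mulr_suml.
apply: ler_sum_nat => i _; rewrite -mulr_sumr ler_wpM2l//.
rewrite -/(series v N) -/(series v (N - i)%N).
by apply: nondecreasing_series_ge0 => //; rewrite leq_subr.
Qed.

(** The square of side [N./2] is contained in the triangle of side [N]. *)
Lemma cauchy_prod_series_ge N :
  series u N./2 * series v N./2 <= series (cauchy_prod u v) N.
Proof.
rewrite /series/= /cauchy_prod (series_triangle (fun i j => u i * v j)) mulr_suml.
have hN : (N./2 <= N)%N by rewrite -{2}[N]odd_double_half -addnn addnA leq_addl.
rewrite [leRHS](@big_cat_nat _ _ _ N./2)//=.
apply: ler_wpDr; first by rewrite big_nat; apply: sumr_ge0 => i _; apply: sumr_ge0 => j _; rewrite mulr_ge0.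
apply: ler_sum_nat => i /andP[_ iN]; rewrite -mulr_sumr ler_wpM2l//.
rewrite -/(series v _) -/(series v (N - i)%N).
apply: nondecreasing_series_ge0 => //.
rewrite leq_subRL; last exact: leq_trans (ltnW iN) hN.
apply: (@leq_trans (N./2 + N./2)); first by rewrite leq_add2r ltnW.
by rewrite -{3}[N]odd_double_half addnn leq_addl.
Qed.

Lemma cauchy_prod_cvg_ge0 (U V : R) : series u @ \oo --> U -> series v @ \oo --> V ->
  series (cauchy_prod u v) @ \oo --> U * V.
Proof.
move=> cu cv.
apply: (@squeeze_cvgr _ _ _ _ (fun N => series u N./2 * series v N./2)
   (fun N => series u N * series v N)).
- by near=> N; rewrite cauchy_prod_series_le cauchy_prod_series_ge.
- by apply: cvgM; apply: (cvg_comp _ _ cvg_half).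
- exact: cvgM.
Unshelve. all: by end_near. Qed.

End NonNeg.

Lemma norm_cauchy_prod_series_le u v N : `|series (cauchy_prod u v) N| <=
  series (fun n => `|u n|) N * series (fun n => `|v n|) N.
Proof.
apply: (le_trans (ler_norm_series _ _)).
apply: le_trans (cauchy_prod_series_le (fun n => normr_ge0 (u n)) (fun n => normr_ge0 (v n)) N).
apply: ler_sum => n _; rewrite /cauchy_prod.
by apply: (le_trans (ler_norm_sum _ _ _)); apply: ler_sum => i _; rewrite normrM.
Qed.

(** The part of the square [[0, N)^2] missed by the triangle is bounded by the
    same part for the absolute values, which vanishes in the limit. *)
Lemma cauchy_prod_cvg u v (U V : R) :
  cvgn (series (fun n => `|u n|)) -> cvgn (series (fun n => `|v n|)) ->
  series u @ \oo --> U -> series v @ \oo --> V ->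
  series (cauchy_prod u v) @ \oo --> U * V.
Proof.
move=> cau cav cu cv.
pose au n := `|u n|; pose av n := `|v n|.
have h : (fun N => series au N * series av N - series (cauchy_prod au av) N)
    @ \oo --> 0.
  rewrite -(subrr (limn (series au) * limn (series av))); apply: cvgB.
    exact: cvgM.
  by apply: cauchy_prod_cvg_ge0 => // n; exact: normr_ge0.
have h2 : (fun N => series u N * series v N - series (cauchy_prod u v) N)
    @ \oo --> 0.
  apply/norm_cvg0P; apply: (squeeze_cvgr _ (cvg_cst _) h).
  near=> N; rewrite normr_ge0/=.
  rewrite /series/= /cauchy_prod !(series_triangle (fun i j => _ i * _ j)).
  have e (a b : nat -> R) : (\sum_(0 <= k < N) a k) * (\sum_(0 <= k < N) b k)
    - \sum_(0 <= i < N) \sum_(0 <= j < N - i) a i * b j =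
     \sum_(0 <= i < N) \sum_(N - i <= j < N) a i * b j.
    rewrite mulr_suml -sumrB; apply: eq_bigr => i _.
    rewrite (@big_cat_nat _ _ _ (N - i)%N)/= ?leq_subr//.
    by rewrite mulrDr !mulr_sumr addrAC subrr add0r.
  rewrite !e; apply: (le_trans (ler_norm_sum _ _ _)); apply: ler_sum => i _.
  by apply: (le_trans (ler_norm_sum _ _ _)); apply: ler_sum => j _; rewrite normrM.
have -> : series (cauchy_prod u v) = (fun N => series u N * series v N -
    (series u N * series v N - series (cauchy_prod u v) N)).
  by apply/funext => N; rewrite subKr.
by rewrite -[X in _ --> X]subr0; apply: cvgB => //; exact: cvgM.
Unshelve. all: by end_near. Qed.

End Series.

Lemma integrable_scale d (T : measurableType d) (R : realType)
    (mu : {measure set T -> \bar R}) (D : set T) (c : R) (f : T -> R) :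
  measurable D -> mu.-integrable D (EFin \o f) ->
  mu.-integrable D (EFin \o (fun x => c * f x)).
Proof. by move=> mD intf; exact: (integrableZl mD c intf). Qed.

(** Dominated convergence for the partial sums; the bound on them also makes each
    term integrable, as a difference of two of them. *)
Lemma cvg_series_Rintegral d (T : measurableType d) (R : realType)
    (mu : {measure set T -> \bar R}) (D : set T) (F : nat -> T -> R) (G g : T -> R) :
  measurable D -> (forall n, measurable_fun D (F n)) ->
  mu.-integrable D (EFin \o g) ->
  (forall x, D x -> series (F ^~ x) @ \oo --> G x) ->
  (forall N x, D x -> `|series (F ^~ x) N| <= g x) ->
  mu.-integrable D (EFin \o G) /\
  series (fun n => \int[mu]_(x in D) F n x) @ \oo --> \int[mu]_(x in D) G x.
Proof.
move=> mD mF ig FG Fg.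
have mS N : measurable_fun D (fun x => series (F ^~ x) N).
  by apply: measurable_sum.
have mG : measurable_fun D G.
  apply: (@measurable_fun_cvg _ _ _ _ (fun N x => series (F ^~ x) N)) => //.
have iF n : mu.-integrable D (EFin \o F n).
  apply: (@le_integrable _ _ _ _ _ mD _ (fun x => 2%:E * (g x)%:E)%E).
  - exact/measurable_EFinP.
  - move=> x Dx /=; rewrite lee_fin -(seriesSB (F ^~ x)).
    apply: (le_trans (ler_normB _ _)).
    have g0 : 0 <= g x := le_trans (normr_ge0 _) (Fg 0%N x Dx).
    rewrite (ger0_norm (mulr_ge0 _ g0))// mulr_natl mulr2n.
    by apply: lerD; exact: Fg.
  - exact: integrableZl.
have mSE N : measurable_fun D (fun x => (series (F ^~ x) N)%:E).
  exact/measurable_EFinP/mS.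
have mGE : measurable_fun D (EFin \o G) by exact/measurable_EFinP.
have cE x : D x -> (fun N => (series (F ^~ x) N)%:E) @ \oo --> (G x)%:E.
  by move=> Dx; apply: cvg_EFin; [exact: nearW|exact: FG].
have [||iG _ cI] := dominated_convergence mD mSE mGE _ ig.
- by apply: aeW => x; exact: cE.
- by apply: aeW => x N Dx; rewrite /= lee_fin; exact: Fg.
split => //.
have e N : (\int[mu]_(x in D) (series (F ^~ x) N)%:E)%E =
    (series (fun n => \int[mu]_(x in D) F n x) N)%:E.
  rewrite /series/= -sumEFin.
  under eq_integral do rewrite -sumEFin.
  rewrite integral_sum//; apply: eq_bigr => i _.
  rewrite /Rintegral fineK//.
  by apply: (integrable_fin_num mD (iF i)).
have fI : (\int[mu]_(x in D) (G x)%:E)%E \is a fin_num by apply: (integrable_fin_num mD iG).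
move: cI; rewrite /= -(fineK fI).
under eq_fun do rewrite e.
by move=> /fine_cvgP[].
Qed.

(** * The Bessel-Clifford function *)

Section BesselClifford.
Context {R : realType}.
Implicit Types (a b l s x y z w : R) (m n N : nat).

Notation mu := (@lebesgue_measure R).
Notation pos := (`]0%R, +oo[%classic : set R).

Definition bc_coef b m : R := (m`!%:R * Gamma (m%:R + b))^-1.

(** This is [z^(-(b-1)/2) I_(b-1) (2 sqrt z)], with [I] the modified Bessel
    function. *)
Definition bessel_clifford b z : R := limn (pseries (bc_coef b) z).

Lemma Gamma_shift_gt0 b m : 0 < b -> 0 < Gamma (m%:R + b).
Proof. by move=> b0; rewrite Gamma_gt0// ltr_wpDl. Qed.

Lemma Gamma_shiftS b m : 0 < b -> Gamma (m.+1%:R + b) = (m%:R + b) * Gamma (m%:R + b).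
Proof.
move=> b0; rewrite -GammaS; last by rewrite ltr_wpDl.
by congr Gamma; rewrite -natr1; ring.
Qed.

Lemma factr_gt0 m : 0 < m`!%:R :> R.
Proof. by rewrite ltr0n fact_gt0. Qed.

Lemma bc_coef_gt0 b m : 0 < b -> 0 < bc_coef b m.
Proof. by move=> b0; rewrite invr_gt0 mulr_gt0 ?factr_gt0 ?Gamma_shift_gt0. Qed.

Lemma bc_coef_ge0 b m : 0 < b -> 0 <= bc_coef b m.
Proof. by move=> b0; rewrite ltW ?bc_coef_gt0. Qed.

Lemma series_exp_coeff_le x N : 0 <= x -> series (exp_coeff x) N <= expR x.
Proof.
move=> x0; apply: series_le_limn => [n|]; last exact: is_cvg_series_exp_coeff.
exact: exp_coeff_ge0.
Qed.

Lemma bc_norm_series_le b (K : R) z N : 0 < b -> 1 <= K ->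
  series (fun m => `|bc_coef b m * z ^+ m|) N <=
  (K + 1) * expR (K + 1) * expR (`|z| / K).
Proof.
move=> b0 K1; have K0 : 0 < K by exact: lt_le_trans K1.
have c0 : 0 <= (K + 1) * expR (K + 1) by rewrite mulr_ge0 ?expR_ge0// addr_ge0// ltW.
apply: (@le_trans _ _ ((K + 1) * expR (K + 1) * series (exp_coeff (`|z| / K)) N)).
  rewrite /series/= mulr_sumr; apply: ler_sum => m _.
  rewrite normrM normrX ger0_norm ?bc_coef_ge0// /bc_coef /exp_coeff/= invfM.
  have hg : (Gamma (m%:R + b))^-1 <= (K + 1) * expR (K + 1) / K ^+ m.
    rewrite -[leRHS]invrK lef_pV2 ?posrE ?Gamma_shift_gt0//; last first.
      by rewrite invr_gt0 divr_gt0 ?exprn_gt0// mulr_gt0 ?expR_gt0// addr_gt0.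
    apply: le_trans (Gamma_ge_geometric m b0 K1).
    by rewrite expRN !invfM invrK mulrC [X in _ * X]mulrC.
  rewrite expr_div_n [leLHS]mulrC [leRHS](_ : _ = `|z| ^+ m *
    ((m`!%:R)^-1 * ((K + 1) * expR (K + 1) / K ^+ m))); last by ring.
  rewrite ler_wpM2l ?exprn_ge0// ler_wpM2l// invr_ge0 ltW// factr_gt0.
by rewrite ler_wpM2l// series_exp_coeff_le// divr_ge0// ltW.
Qed.

Lemma bc_norm_cvg b z : 0 < b ->
  cvgn (series (fun m => `|bc_coef b m * z ^+ m|)).
Proof.
move=> b0; apply: series_ge0_cvg_bound => [n|n]; first exact: normr_ge0.
exact: bc_norm_series_le (lexx 1).
Qed.

Lemma bc_cvg b z : 0 < b -> pseries (bc_coef b) z @ \oo --> bessel_clifford b z.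
Proof. by move=> b0; apply: norm_series_cvg; exact: bc_norm_cvg. Qed.

Lemma bc_norm_le b (z M : R) : 0 < b ->
  (forall N, series (fun m => `|bc_coef b m * z ^+ m|) N <= M) ->
  `|bessel_clifford b z| <= M.
Proof.
move=> b0 h; have c := @bc_cvg b z b0.
rewrite -(cvg_lim _ (cvg_norm c))//; apply: limr_le.
  by apply/cvg_ex; eexists; exact: (cvg_norm c).
by near=> n; apply: (le_trans (ler_norm_series _ _)).
Unshelve. all: by end_near. Qed.

(** Every exponential rate is allowed, since [1 / Gamma (m + b)] decays faster
    than any geometric sequence; products of two such series can then be
    integrated against any decaying exponential. *)
Lemma bc_growth b a e : 0 < b -> 0 <= a -> 0 < e ->
  exists2 C : R, 0 <= C & forall s z N, 0 <= s -> `|z| <= a * s ->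
    series (fun m => `|bc_coef b m * z ^+ m|) N <= C * expR (e * s).
Proof.
move=> b0 a0 e0; pose K := Num.max 1 (a / e).
have K1 : 1 <= K by rewrite le_max lexx.
have K0 : 0 < K by exact: lt_le_trans K1.
exists ((K + 1) * expR (K + 1)); first by rewrite mulr_ge0 ?expR_ge0// addr_ge0// ltW.
move=> s z N s0 zas; apply: (le_trans (bc_norm_series_le z N b0 K1)).
apply: ler_wpM2l; first by rewrite mulr_ge0 ?expR_ge0// addr_ge0// ltW.
rewrite ler_expR ler_pdivrMr//; apply: (le_trans zas).
rewrite mulrAC ler_wpM2r// -ler_pdivrMl//.
by rewrite mulrC /K le_max lexx orbT.
Qed.

Lemma bc_ge0 b z : 0 < b -> 0 <= z -> 0 <= bessel_clifford b z.
Proof.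
move=> b0 z0; apply: limr_ge; first by apply/cvg_ex; eexists; exact: bc_cvg.
by near=> n; apply: sumr_ge0 => i _; rewrite mulr_ge0 ?bc_coef_ge0 ?exprn_ge0.
Unshelve. all: by end_near. Qed.

Lemma bc_coef0 b : bc_coef b 0 = (Gamma b)^-1.
Proof. by rewrite /bc_coef fact0 mul1r add0r. Qed.

Lemma bc0 b : 0 < b -> bessel_clifford b 0 = (Gamma b)^-1.
Proof.
move=> b0; apply/cvg_lim => //; rewrite -cvg_shiftS.
apply: cvg_near_cst; near=> n.
rewrite /pseries/= /series/= big_nat_recl// big1 ?addr0.
  by rewrite expr0 mulr1 bc_coef0.
by move=> i _; rewrite expr0n mulr0.
Unshelve. all: by end_near. Qed.

Lemma pseries_diffs_bc_coef b : pseries_diffs (bc_coef b) = bc_coef (b + 1).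
Proof.
apply/funext => m; rewrite /pseries_diffs /bc_coef factS natrM.
have -> : m.+1%:R + b = m%:R + (b + 1) by rewrite -natr1; ring.
by rewrite -mulrA invfM mulVKf.
Qed.

Lemma is_derive_bc b z : 0 < b ->
  is_derive z (1 : R) (bessel_clifford b) (bessel_clifford (b + 1) z).
Proof.
move=> b0; have b1 : 0 < b + 1 by rewrite addr_gt0.
have b2 : 0 < b + 1 + 1 by rewrite addr_gt0.
rewrite /bessel_clifford -pseries_diffs_bc_coef.
apply: (@pseries_snd_diffs _ _ (`|z| + 1)); rewrite ?pseries_diffs_bc_coef.
- by apply/cvg_ex; eexists; exact: bc_cvg.
- by apply/cvg_ex; eexists; exact: bc_cvg.
- by apply/cvg_ex; eexists; exact: bc_cvg.
- by rewrite [ltRHS]ger0_norm ?addr_ge0// ltrDl.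
Qed.

Lemma continuous_bc b : 0 < b -> continuous (bessel_clifford b).
Proof.
move=> b0 z; apply: differentiable_continuous; apply/derivable1_diffP.
by have [] := is_derive_bc z b0.
Qed.

Lemma measurable_bc b : 0 < b -> measurable_fun [set: R] (bessel_clifford b).
Proof. by move=> b0; apply: continuous_measurable_fun; exact: continuous_bc. Qed.

(** The three-term relation behind the Bessel equation; it holds coefficient
    by coefficient. *)
Lemma bc_recurrence b z : 0 < b -> bessel_clifford b z =
  b * bessel_clifford (b + 1) z + z * bessel_clifford (b + 1 + 1) z.
Proof.
move=> b0; have b1 : 0 < b + 1 by rewrite addr_gt0.
have b2 : 0 < b + 1 + 1 by rewrite addr_gt0.
apply/cvg_lim => //.
have h : (fun N => b * pseries (bc_coef (b + 1)) z N.+1 + z * pseries (bc_coef (b + 1 + 1)) z N)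
    @ \oo --> b * bessel_clifford (b + 1) z + z * bessel_clifford (b + 1 + 1) z.
  apply: cvgD; apply: cvgMr; last exact: bc_cvg.
  by have := @bc_cvg _ z b1; rewrite -cvg_shiftS.
rewrite -cvg_shiftS; apply: cvg_trans h; apply: near_eq_cvg; near=> N.
rewrite /pseries/= /series/= !mulr_sumr [X in X + _]big_nat_recl// [RHS]big_nat_recl//.
rewrite -addrA -big_split/=; congr (_ + _).
  rewrite !expr0 !mulr1 !bc_coef0 (GammaS b0).
  have := Gamma_gt0 b0; move: (Gamma b) => g g0.
  by field; rewrite !gt_eqF.
apply: eq_bigr => m _; rewrite exprS.
have e1 : m.+1%:R + b = m%:R + (b + 1) by rewrite -natr1; ring.
have e2 : m.+1%:R + (b + 1) = m%:R + (b + 1) + 1 by rewrite -natr1; ring.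
have e3 : m%:R + (b + 1 + 1) = m%:R + (b + 1) + 1 by ring.
rewrite /bc_coef e1 e2 e3 factS natrM -[m.+1%:R]natr1.
have mb : 0 < m%:R + (b + 1) by rewrite ltr_wpDl.
rewrite GammaS//.
have := @factr_gt0 m; have := @Gamma_shift_gt0 (b + 1) m b1.
move: (Gamma _) (m`!%:R) => g f g0 f0.
have m0 : 0 < m%:R + 1 :> R by rewrite ltr_wpDl.
by field; rewrite !gt_eqF.
Unshelve. all: by end_near. Qed.

End BesselClifford.

(** * Laguerre polynomials *)

Section Laguerre.
Context {R : realType}.
Implicit Types (a b l s x y z w : R) (m n N : nat).

Notation mu := (@lebesgue_measure R).
Notation pos := (`]0%R, +oo[%classic : set R).

(** This is [n! L_n^{b - 1}(x)], from the explicit coefficients. *)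
Definition lag b n x : R :=
  \sum_(i < n.+1) 'C(n, i)%:R * (Gamma (n%:R + b) / Gamma (i%:R + b)) * (- x) ^+ i.

Lemma bin_factr n i : (i <= n)%N ->
  'C(n, i)%:R = n`!%:R / (i`!%:R * (n - i)`!%:R) :> R.
Proof.
move=> le_in; by rewrite -(bin_fact le_in) !natrM mulfK// gt_eqF// mulr_gt0// factr_gt0.
Qed.

(** The explicit coefficients of a Laguerre polynomial are those of a Cauchy
    product with the exponential series. *)
Lemma lag_gen_coef b n x s : 0 < b ->
  cauchy_prod (fun i => bc_coef b i * (- (x * s)) ^+ i) (exp_coeff s) n =
  s ^+ n * lag b n x * bc_coef b n.
Proof.
move=> b0; rewrite /cauchy_prod /lag mulr_sumr mulr_suml; apply: eq_bigr => i _.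
have le_in : (i <= n)%N by rewrite -ltnS.
have -> : s ^+ n = s ^+ i * s ^+ (n - i) by rewrite -exprD subnKC.
rewrite bin_factr// /bc_coef /exp_coeff/= -mulNr exprMn.
have := @Gamma_shift_gt0 R b n b0; have := @Gamma_shift_gt0 R b i b0.
have := @factr_gt0 R n; have := @factr_gt0 R i; have := @factr_gt0 R (n - i).
move: (n`!%:R) (i`!%:R) ((n - i)`!%:R) (Gamma (n%:R + b)) (Gamma (i%:R + b)).
by move=> f1 f2 f3 g1 g2 *; field; rewrite !gt_eqF.
Qed.

Lemma exp_coeff_norm_cvg (x : R) : cvgn (series (fun n => `|exp_coeff x n|)).
Proof.
have -> : (fun n => `|exp_coeff x n|) = exp_coeff `|x|.
  by apply/funext => n; rewrite /exp_coeff/= normrM normrX normfV (ger0_norm (ler0n _ _)).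
exact: is_cvg_series_exp_coeff.
Qed.

Lemma exp_coeff_norm_series_le (x : R) N : series (fun n => `|exp_coeff x n|) N <= expR `|x|.
Proof.
have -> : (fun n => `|exp_coeff x n|) = exp_coeff `|x|.
  by apply/funext => n; rewrite /exp_coeff/= normrM normrX normfV (ger0_norm (ler0n _ _)).
exact: series_exp_coeff_le.
Qed.

Lemma lag_generating b x s : 0 < b ->
  series (fun n => s ^+ n * lag b n x * bc_coef b n) @ \oo -->
  expR s * bessel_clifford b (- (x * s)).
Proof.
move=> b0; rewrite mulrC.
have -> : (fun n => s ^+ n * lag b n x * bc_coef b n) =
    cauchy_prod (fun i => bc_coef b i * (- (x * s)) ^+ i) (exp_coeff s).
  by apply/funext => n; rewrite lag_gen_coef.
apply: cauchy_prod_cvg; first exact: bc_norm_cvg.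
- exact: exp_coeff_norm_cvg.
- exact: bc_cvg.
- exact: is_cvg_series_exp_coeff.
Qed.

Lemma lag_generating_le b x s N : 0 < b ->
  `|series (fun n => s ^+ n * lag b n x * bc_coef b n) N| <=
  series (fun m => `|bc_coef b m * (- (x * s)) ^+ m|) N * expR `|s|.
Proof.
move=> b0.
have -> : (fun n => s ^+ n * lag b n x * bc_coef b n) =
    cauchy_prod (fun i => bc_coef b i * (- (x * s)) ^+ i) (exp_coeff s).
  by apply/funext => n; rewrite lag_gen_coef.
apply: (le_trans (norm_cauchy_prod_series_le _ _ _)).
rewrite ler_wpM2l ?exp_coeff_norm_series_le//.
by apply: sumr_ge0 => i _; exact: normr_ge0.
Qed.

Lemma Gamma_shift1 b m : Gamma (m.+1%:R + b) = Gamma (m%:R + (b + 1)) :> R.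
Proof. by congr Gamma; rewrite -natr1; ring. Qed.

(** Vandermonde's convolution for rising factorials
    [(b)_n = Gamma (n + b) / Gamma b]. *)
Lemma Gamma_vandermonde b m n : 0 < b ->
  \sum_(i < m.+1) 'C(m, i)%:R * (n ^_ i)%:R * (Gamma (n%:R + b) / Gamma (i%:R + b))
  = Gamma (m%:R + n%:R + b) / Gamma (m%:R + b) :> R.
Proof.
elim: m n b => [|m ih] n b b0.
  by rewrite big_ord1 bin0 ffactn0 !mul1r !add0r.
rewrite big_ord_recl bin0 ffactn0 mul1r.
under eq_bigr => i _ do rewrite lift0 binS natrD 2!mulrDl.
rewrite big_split/= addrA.
have -> : 1 * (Gamma (n%:R + b) / Gamma (0%:R + b)) +
    \sum_(i < m.+1) 'C(m, i.+1)%:R * (n ^_ i.+1)%:R * (Gamma (n%:R + b) / Gamma (i.+1%:R + b))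
    = Gamma (m%:R + n%:R + b) / Gamma (m%:R + b) :> R.
  rewrite -ih// [in RHS]big_ord_recl bin0 ffactn0 !mul1r; congr (_ + _).
  by rewrite big_ord_recr/= bin_small// !mul0r addr0.
case: n => [|n].
  rewrite big1 ?addr0; last by move=> i _; rewrite ffact0n/= mulr0 mul0r.
  by rewrite !divff ?gt_eqF ?Gamma_shift_gt0.
have b1 : 0 < b + 1 by rewrite addr_gt0.
have -> : \sum_(i < m.+1) 'C(m, i)%:R * (n.+1 ^_ i.+1)%:R *
    (Gamma (n.+1%:R + b) / Gamma (i.+1%:R + b)) = n.+1%:R *
    \sum_(i < m.+1) 'C(m, i)%:R * (n ^_ i)%:R *
    (Gamma (n%:R + (b + 1)) / Gamma (i%:R + (b + 1))) :> R.
  rewrite mulr_sumr; apply: eq_bigr => i _.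
  by rewrite ffactnS natrM !Gamma_shift1 -!mulrA mulrCA.
rewrite (ih _ _ b1).
have -> : m%:R + n%:R + (b + 1) = m%:R + n.+1%:R + b by rewrite -natr1; ring.
have -> : m.+1%:R + n.+1%:R + b = m%:R + n.+1%:R + b + 1 by rewrite -[m.+1%:R]natr1; ring.
rewrite GammaS ?ltr_wpDl ?addr_ge0// -Gamma_shift1 Gamma_shiftS//.
have mb0 : 0 < m%:R + b by rewrite ltr_wpDl.
have := Gamma_shift_gt0 m b0.
move: (Gamma (m%:R + b)) (Gamma _) => g h g0.
by field; rewrite !gt_eqF.
Qed.

Definition lag_coef b n x i : R :=
  'C(n, i)%:R * (Gamma (n%:R + b) / Gamma (i%:R + b)) * (- x) ^+ i.

Lemma series_lag_coef b n x N : (n < N)%N -> series (lag_coef b n x) N = lag b n x.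
Proof.
move=> nN; rewrite /series/= (@big_cat_nat _ _ _ n.+1)//= (_ : \sum_(n.+1 <= i < N) _ = 0).
  by rewrite addr0 big_mkord.
rewrite big_nat big1// => i /andP[ni _].
by rewrite /lag_coef bin_small// !mul0r.
Qed.

Lemma lag_coef_cvg b n x : series (lag_coef b n x) @ \oo --> lag b n x.
Proof.
apply: cvg_near_cst; near=> N; apply: series_lag_coef.
by near: N; exact: nbhs_infty_gt.
Unshelve. all: by end_near. Qed.

Lemma lag_coef_norm_cvg b n x : cvgn (series (fun i => `|lag_coef b n x i|)).
Proof.
apply/cvg_ex; exists (series (fun i => `|lag_coef b n x i|) n.+1).
apply: cvg_near_cst; near=> N.
have nN : (n < N)%N by near: N; exact: nbhs_infty_gt.
rewrite /series/= (@big_cat_nat _ _ _ n.+1)//= (_ : \sum_(n.+1 <= i < N) _ = 0) ?addr0//.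
rewrite big_nat big1// => i /andP[ni _].
by rewrite /lag_coef bin_small// !mul0r normr0.
Unshelve. all: by end_near. Qed.

(** Kummer's transformation of the confluent hypergeometric function, in the
    case where one side is a polynomial. *)
Lemma lag_kummer b n x : 0 < b ->
  series (fun m => bc_coef b m * Gamma (m%:R + n%:R + b) * (- x) ^+ m) @ \oo -->
  lag b n x * expR (- x).
Proof.
move=> b0.
have -> : (fun m => bc_coef b m * Gamma (m%:R + n%:R + b) * (- x) ^+ m) =
    cauchy_prod (lag_coef b n x) (exp_coeff (- x)).
  apply/funext => m; rewrite /cauchy_prod.
  have -> : bc_coef b m * Gamma (m%:R + n%:R + b) * (- x) ^+ m =
      (m`!%:R)^-1 * (Gamma (m%:R + n%:R + b) / Gamma (m%:R + b)) * (- x) ^+ m.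
    by rewrite /bc_coef invfM -!mulrA; congr (_ * _); rewrite mulrCA.
  rewrite -Gamma_vandermonde// mulr_sumr mulr_suml; apply: eq_bigr => i _.
  have le_im : (i <= m)%N by rewrite -ltnS.
  have -> : (- x) ^+ m = (- x) ^+ i * (- x) ^+ (m - i) by rewrite -exprD subnKC.
  rewrite /lag_coef /exp_coeff/= -bin_ffact natrM (bin_factr le_im).
  have := @factr_gt0 R m; have := @factr_gt0 R i; have := @factr_gt0 R (m - i).
  move: (_ / Gamma _) (m`!%:R) (i`!%:R) ((m - i)`!%:R) ('C(n, i)%:R).
  by move=> g f1 f2 f3 c *; field; rewrite !gt_eqF.
apply: cauchy_prod_cvg.
- exact: lag_coef_norm_cvg.
- exact: exp_coeff_norm_cvg.
- exact: lag_coef_cvg.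
- exact: is_cvg_series_exp_coeff.
Qed.

Lemma laplace_power_exprn c l s m : 0 < s ->
  laplace_power c l s * s ^+ m = laplace_power (m%:R + c) l s.
Proof.
move=> s0; rewrite /laplace_power -addrA (powRD_gt0 m%:R (c - 1) s0) powR_mulrn ?(ltW s0)//.
by ring.
Qed.

Lemma laplace_power_bc_term b c l x s m : 0 < s ->
  laplace_power c l s * (bc_coef b m * (- (x * s)) ^+ m) =
  bc_coef b m * (- x) ^+ m * laplace_power (m%:R + c) l s.
Proof.
by move=> s0; rewrite -laplace_power_exprn// -mulNr exprMn; ring.
Qed.

Lemma laplace_power_expR c l e s :
  laplace_power c l s * expR (e * s) = laplace_power c (l - e) s.
Proof.
by rewrite /laplace_power -mulrA -expRD; congr (_ * expR _); ring.
Qed.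

Lemma Rintegral_laplace_power c l : 0 < c -> 0 < l ->
  \int[mu]_(s in pos) laplace_power c l s = Gamma c * l `^ (- c).
Proof. by move=> c0 l0; rewrite /Rintegral integral_laplace_power. Qed.

(** Termwise integration turns [s^m] into [Gamma (m + n + b)], and the resulting
    series is summed by Kummer's transformation. *)
Lemma lag_laplace b n x l : 0 < b -> 0 < l ->
  mu.-integrable pos (EFin \o (fun s => laplace_power (n%:R + b) l s *
    bessel_clifford b (- (x * s)))) /\
  \int[mu]_(s in pos) (laplace_power (n%:R + b) l s * bessel_clifford b (- (x * s)))
  = l `^ (- (n%:R + b)) * (lag b n (x / l) * expR (- (x / l))).
Proof.
move=> b0 l0.
have nb0 : 0 < n%:R + b by rewrite ltr_wpDl.
have l20 : 0 < l - l / 2 by rewrite subr_gt0 ltr_pdivrMr// ltr_pMr// ltr1n.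
have [C C0 bC] := bc_growth b0 (normr_ge0 x) (divr_gt0 l0 (ltr0n R 2)).
have [||||iG cI] := @cvg_series_Rintegral _ _ R mu pos
  (fun m s => laplace_power (n%:R + b) l s * (bc_coef b m * (- (x * s)) ^+ m))
  (fun s => laplace_power (n%:R + b) l s * bessel_clifford b (- (x * s)))
  (fun s => C * laplace_power (n%:R + b) (l - l / 2) s) (measurable_itv _).
- move=> m; apply: (@measurable_funS _ _ _ _ setT) => //.
  apply: measurable_funM; first exact: measurable_laplace_power.
  apply: measurable_funM => //; apply: measurable_funX.
  by apply: measurableT_comp => //; exact: measurable_funM.
- by apply: integrable_scale => //; exact: integrable_laplace_power.
- move=> s _.
  have -> : series (fun m => laplace_power (n%:R + b) l s * (bc_coef b m * (- (x * s)) ^+ m))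
    = (fun N => laplace_power (n%:R + b) l s * pseries (bc_coef b) (- (x * s)) N).
    by rewrite seriesMl.
  by apply: cvgMr; exact: bc_cvg.
- move=> N s; rewrite /= in_itv/= andbT => s0.
  rewrite -laplace_power_expR mulrCA.
  apply: (le_trans (ler_norm_series _ _)).
  apply: (@le_trans _ _ (laplace_power (n%:R + b) l s *
     series (fun m => `|bc_coef b m * (- (x * s)) ^+ m|) N)).
    rewrite /series/= mulr_sumr; apply: ler_sum => m _.
    by rewrite normrM (ger0_norm (laplace_power_ge0 _ _ _)).
  rewrite ler_wpM2l ?laplace_power_ge0//; apply: bC; first exact: ltW.
  by rewrite normrN normrM (ger0_norm (ltW s0)).
split => //; move: cI.
have -> : (fun m => \int[mu]_(s in pos)
    (laplace_power (n%:R + b) l s * (bc_coef b m * (- (x * s)) ^+ m))) =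
  (fun m => l `^ (- (n%:R + b)) * (bc_coef b m * Gamma (m%:R + n%:R + b) * (- (x / l)) ^+ m)).
  apply/funext => m.
  transitivity (\int[mu]_(s in pos) (bc_coef b m * (- x) ^+ m * laplace_power (m%:R + (n%:R + b)) l s)).
    apply: eq_Rintegral => s; rewrite inE/= in_itv/= andbT => s0.
    exact: laplace_power_bc_term.
  have mnb : 0 < m%:R + (n%:R + b) by rewrite ltr_wpDl.
  rewrite RintegralZl//; last exact: integrable_laplace_power.
  rewrite Rintegral_laplace_power// opprD powRD_gt0// [X in _ * (_ * (X * _))]powRN.
  rewrite powR_mulrn ?(ltW l0)// -mulNr exprMn exprVn addrA.
  by ring.
move=> cI; apply: (cvg_series_unique cI).
by apply: cvg_seriesMl; exact: lag_kummer.
Qed.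

End Laguerre.

(** * The Hille-Hardy formula *)

Section HilleHardy.
Context {R : realType}.
Implicit Types (a b l s x y z w : R) (m n N : nat).

Notation mu := (@lebesgue_measure R).
Notation pos := (`]0%R, +oo[%classic : set R).

Variables (b w x y : R).
Hypotheses (b0 : 0 < b) (w0 : 0 < w) (w1 : w < 1).

Let u s : R := laplace_power b (1 - w) s * bessel_clifford b (- (x * s)) *
  bessel_clifford b (- (y * (w * s))).

Let w10 : 0 < 1 - w. Proof. by rewrite subr_gt0. Qed.

Let measurable_bc_scale (c : R) : measurable_fun [set: R] (fun s => bessel_clifford b (- (c * s))).
Proof.
apply: measurableT_comp; first exact: measurable_bc.
by apply: measurableT_comp => //; exact: measurable_funM.
Qed.

(* Two factors of rate (1 - w) / 4 leave a decay of rate (1 - w) / 2. *)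
Let growth (c : R) : exists2 C : R, 0 <= C & forall s N, 0 <= s ->
  series (fun m => `|bc_coef b m * (- (c * s)) ^+ m|) N <= C * expR ((1 - w) / 4 * s).
Proof.
have [C C0 hC] := bc_growth b0 (normr_ge0 c) (divr_gt0 w10 (ltr0n R 4)).
exists C => // s N s0; apply: hC => //.
by rewrite normrN normrM (ger0_norm s0).
Qed.

Let integrable_bound (C : R) : mu.-integrable pos (EFin \o
  (fun s => C * laplace_power b ((1 - w) / 2) s)).
Proof.
apply: integrable_scale; first exact: measurable_itv.
by apply: integrable_laplace_power => //; rewrite divr_gt0.
Qed.

Let bound_split s : laplace_power b 1 s * expR ((1 - w) / 4 * s) *
   (expR ((1 - w) / 4 * s) * expR (w * s)) = laplace_power b ((1 - w) / 2) s.
Proof. by rewrite mulrA !laplace_power_expR; congr (laplace_power _ _ _); field. Qed.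

Let sum_laplace :
  series (fun n => w ^+ n * lag b n x * lag b n y * bc_coef b n * expR (- x)) @ \oo -->
  \int[mu]_(s in pos) u s.
Proof.
have [C1 C10 h1] := growth x; have [C2 C20 h2] := growth (y * w).
have [||||_] := @cvg_series_Rintegral _ _ R mu pos
  (fun n s => laplace_power b 1 s * bessel_clifford b (- (x * s)) *
    ((w * s) ^+ n * lag b n y * bc_coef b n)) u
  (fun s => C1 * C2 * laplace_power b ((1 - w) / 2) s) (measurable_itv _).
- move=> n; apply: (@measurable_funS _ _ _ _ setT) => //.
  apply: measurable_funM.
    by apply: measurable_funM; [exact: measurable_laplace_power|exact: measurable_bc_scale].
  apply: measurable_funM => //; apply: measurable_funM => //.
  by apply: measurable_funX; exact: measurable_funM.
- exact: integrable_bound.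
- move=> s _; rewrite seriesMl.
  have -> : u s = laplace_power b 1 s * bessel_clifford b (- (x * s)) *
      (expR (w * s) * bessel_clifford b (- (y * (w * s)))).
    by rewrite /u -laplace_power_expR; ring.
  by apply: cvgMr; exact: lag_generating.
- move=> N s; rewrite /= in_itv/= andbT => s0.
  rewrite seriesMl 2!normrM (ger0_norm (laplace_power_ge0 _ _ _)).
  rewrite -(bound_split s).
  have -> : C1 * C2 * (laplace_power b 1 s * expR ((1 - w) / 4 * s) *
    (expR ((1 - w) / 4 * s) * expR (w * s))) =
    laplace_power b 1 s * (C1 * expR ((1 - w) / 4 * s)) *
    (C2 * expR ((1 - w) / 4 * s) * expR (w * s)) by ring.
  apply: ler_pM => //; first by rewrite mulr_ge0 ?laplace_power_ge0.
    rewrite ler_wpM2l ?laplace_power_ge0//.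
    by apply: bc_norm_le => // M; apply: h1; exact: ltW.
  apply: (le_trans (lag_generating_le _ _ _ b0)).
  rewrite (ger0_norm (mulr_ge0 (ltW w0) (ltW s0))) ler_wpM2r ?expR_ge0//.
  by rewrite mulrA; apply: h2; exact: ltW.
suff -> : (fun n => \int[mu]_(s in pos) (laplace_power b 1 s * bessel_clifford b (- (x * s)) *
    ((w * s) ^+ n * lag b n y * bc_coef b n))) =
  (fun n => w ^+ n * lag b n x * lag b n y * bc_coef b n * expR (- x)) by [].
apply/funext => n; have [iL eL] := lag_laplace n x b0 ltr01.
transitivity (\int[mu]_(s in pos) (w ^+ n * lag b n y * bc_coef b n *
   (laplace_power (n%:R + b) 1 s * bessel_clifford b (- (x * s))))).
  apply: eq_Rintegral => s; rewrite inE/= in_itv/= andbT => s0.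
  have e := @laplace_power_exprn R b 1 s n s0.
  by rewrite -e exprMn; ring.
rewrite RintegralZl//.
by rewrite eL powR1 divr1; ring.
Qed.

Let laplace_sum : \int[mu]_(s in pos) u s =
  (1 - w) `^ (- b) * expR (- (x / (1 - w))) * (expR (- (y * w) / (1 - w)) *
    bessel_clifford b (- (x / (1 - w) * (- (y * w) / (1 - w))))).
Proof.
have [C1 C10 h1] := growth x; have [C2 C20 h2] := growth (y * w).
have [||||_] := @cvg_series_Rintegral _ _ R mu pos
  (fun m s => laplace_power b (1 - w) s * bessel_clifford b (- (x * s)) *
    (bc_coef b m * (- (y * (w * s))) ^+ m)) u
  (fun s => C1 * C2 * laplace_power b ((1 - w) / 2) s) (measurable_itv _).
- move=> n; apply: (@measurable_funS _ _ _ _ setT) => //.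
  apply: measurable_funM.
    by apply: measurable_funM; [exact: measurable_laplace_power|exact: measurable_bc_scale].
  apply: measurable_funM => //; apply: measurable_funX; apply: measurableT_comp => //.
  by apply: measurable_funM => //; exact: measurable_funM.
- exact: integrable_bound.
- move=> s _; rewrite seriesMl.
  by apply: cvgMr; exact: bc_cvg.
- move=> N s; rewrite /= in_itv/= andbT => s0.
  rewrite seriesMl 2!normrM (ger0_norm (laplace_power_ge0 _ _ _)).
  rewrite -(bound_split s).
  have -> : C1 * C2 * (laplace_power b 1 s * expR ((1 - w) / 4 * s) *
    (expR ((1 - w) / 4 * s) * expR (w * s))) =
    laplace_power b 1 s * expR (w * s) * (C1 * expR ((1 - w) / 4 * s)) *
    (C2 * expR ((1 - w) / 4 * s)) by ring.
  rewrite laplace_power_expR.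
  apply: ler_pM => //; first by rewrite mulr_ge0 ?laplace_power_ge0.
    rewrite ler_wpM2l ?laplace_power_ge0//.
    by apply: bc_norm_le => // M; apply: h1; exact: ltW.
  apply: (le_trans (ler_norm_series _ _)).
  by rewrite mulrA; apply: h2; exact: ltW.
move=> cI; apply: (cvg_series_unique cI).
have -> : (fun m => \int[mu]_(s in pos) (laplace_power b (1 - w) s * bessel_clifford b (- (x * s)) *
    (bc_coef b m * (- (y * (w * s))) ^+ m))) =
  (fun m => (1 - w) `^ (- b) * expR (- (x / (1 - w))) * ((- (y * w) / (1 - w)) ^+ m *
     lag b m (x / (1 - w)) * bc_coef b m)).
  apply/funext => m; have [iL eL] := lag_laplace m x b0 w10.
  transitivity (\int[mu]_(s in pos) (bc_coef b m * (- (y * w)) ^+ m *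
     (laplace_power (m%:R + b) (1 - w) s * bessel_clifford b (- (x * s))))).
    apply: eq_Rintegral => s; rewrite inE/= in_itv/= andbT => s0.
    have e := @laplace_power_bc_term R b b (1 - w) (y * w) s m s0.
    by rewrite (mulrA _ (laplace_power _ _ _)) -e (mulrA y w s); ring.
  rewrite RintegralZl//.
  rewrite eL opprD powRD_gt0// [X in _ * (X * _ * _)]powRN powR_mulrn ?(ltW w10)//.
  by rewrite exprMn exprVn; ring.
by apply: cvg_seriesMl; exact: lag_generating.
Qed.

(** One Laguerre factor is written as a Laplace transform, the other is summed
    by its generating function; expanding the resulting product of two
    Bessel-Clifford functions the other way round gives back a Laplace transform
    of Laguerre type, summed by the same generating function. *)
Lemma hille_hardy :
  series (fun n => w ^+ n * lag b n x * lag b n y * bc_coef b n) @ \oo -->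
  (1 - w) `^ (- b) * expR (- ((x + y) * (w / (1 - w)))) *
  bessel_clifford b (x * y * w / (1 - w) ^+ 2).
Proof.
have c := cvg_seriesMl (c := expR x) sum_laplace.
have e1 : (fun n => expR x * (w ^+ n * lag b n x * lag b n y * bc_coef b n * expR (- x))) =
    (fun n => w ^+ n * lag b n x * lag b n y * bc_coef b n).
  by apply/funext => n; rewrite mulrCA expRxMexpNx_1 mulr1.
rewrite e1 laplace_sum in c.
suff <- : expR x * ((1 - w) `^ (- b) * expR (- (x / (1 - w))) * (expR (- (y * w) / (1 - w)) *
    bessel_clifford b (- (x / (1 - w) * (- (y * w) / (1 - w)))))) =
  (1 - w) `^ (- b) * expR (- ((x + y) * (w / (1 - w)))) *
  bessel_clifford b (x * y * w / (1 - w) ^+ 2) by [].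
have -> : - (x / (1 - w) * (- (y * w) / (1 - w))) = x * y * w / (1 - w) ^+ 2.
  by field; rewrite gt_eqF.
have -> : - ((x + y) * (w / (1 - w))) = x + (- (x / (1 - w)) + - (y * w) / (1 - w)).
  by field; rewrite gt_eqF.
by rewrite !expRD; ring.
Qed.

End HilleHardy.

(** * The Dunkl kernel *)

Section DunklKernel.
Context {R : realType}.
Implicit Types (b x y z : R).

(** Up to the factor [1 / Gamma b] this is the Dunkl kernel of index [b - 1/2]
    at [2z], split into its even and odd parts. *)
Definition dunkl_kernel b z : R :=
  bessel_clifford b (z ^+ 2) + z * bessel_clifford (b + 1) (z ^+ 2).

Lemma is_derive_dunkl_kernel b z : 0 < b -> is_derive z (1 : R)
  (fun z => expR (- 2 * z) * dunkl_kernel b z)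
  (- ((2 * b - 1) * expR (- 2 * z) * bessel_clifford (b + 1) (z ^+ 2))).
Proof.
move=> b0; have b1 : 0 < b + 1 by rewrite addr_gt0.
have dsq : is_derive z (1 : R) (fun z : R => z ^+ 2) (2 * z).
  exact: (is_derive_eq (is_derive_exprn 2 z)).
have d0 := @is_derive1_comp R (bessel_clifford b) (fun y => y ^+ 2) z _ _ (is_derive_bc (z ^+ 2) b0) dsq.
have d1 := @is_derive1_comp R (bessel_clifford (b + 1)) (fun y => y ^+ 2) z _ _ (is_derive_bc (z ^+ 2) b1) dsq.
have dz := is_derive_id z (1 : R).
have d := is_derive_mul (is_derive_expRM (- 2) z) (is_derive_add d0 (is_derive_mul dz d1)).
apply: (is_derive_eq d) => /=.
rewrite (bc_recurrence (z ^+ 2) b0).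
set A := bessel_clifford (b + 1) _; set B := bessel_clifford (b + 1 + 1) _.
by ring.
Qed.

(** For [z > 0] this bounds the kernel from above by [expR (2 z)]; for [z < 0] it
    bounds the kernel from below by a positive function. The derivative is
    nonpositive exactly when [b >= 1/2], that is [k >= 0]. *)
Lemma dunkl_kernel_mono b x y : 2^-1 <= b -> x <= y ->
  expR (- 2 * y) * dunkl_kernel b y <= expR (- 2 * x) * dunkl_kernel b x.
Proof.
move=> b2 xy; have b0 : 0 < b by apply: lt_le_trans b2; rewrite invr_gt0.
have b1 : 0 < b + 1 by rewrite addr_gt0.
pose f z := expR (- 2 * z) * dunkl_kernel b z.
have df z := is_derive_dunkl_kernel z b0.
apply: (@ler0_derive1_le_cc R f x y); rewrite ?in_itv/= ?lexx ?xy//.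
- move=> z _; rewrite derive1E; have [_ ->] := df z.
  rewrite oppr_le0 !mulr_ge0 ?expR_ge0 ?bc_ge0 ?sqr_ge0//.
  by rewrite subr_ge0 mulrC -ler_pdivrMr// mul1r.
- by apply: derivable_within_continuous => z _; have [] := df z.
Qed.

Lemma dunkl_kernel_ge0 b z : 2^-1 <= b -> 0 <= dunkl_kernel b z.
Proof.
move=> b2; have b0 : 0 < b by apply: lt_le_trans b2; rewrite invr_gt0.
have b1 : 0 < b + 1 by rewrite addr_gt0.
have [z0|z0] := leP 0 z.
  by rewrite addr_ge0 ?mulr_ge0 ?bc_ge0// sqr_ge0.
have := dunkl_kernel_mono b2 (ltW z0); rewrite mulr0 expR0 mul1r.
rewrite {1}/dunkl_kernel expr0n/= mul0r addr0 bc0// => h.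
rewrite -(pmulr_rge0 _ (expR_gt0 (- 2 * z))); apply: le_trans h.
by rewrite invr_ge0 ltW// Gamma_gt0.
Qed.

Lemma dunkl_kernel_le b z : 2^-1 <= b -> 0 <= z -> dunkl_kernel b z <= (Gamma b)^-1 * expR (2 * z).
Proof.
move=> b2 z0; have b0 : 0 < b by apply: lt_le_trans b2; rewrite invr_gt0.
have := dunkl_kernel_mono b2 z0; rewrite mulr0 expR0 mul1r.
rewrite [leRHS]/dunkl_kernel expr0n/= mul0r addr0 bc0//.
by rewrite mulNr expRN mulrC ler_pdivrMr ?expR_gt0.
Qed.

Lemma measurable_dunkl_kernel b : 0 < b -> measurable_fun [set: R] (dunkl_kernel b).
Proof.
move=> b0; have b1 : 0 < b + 1 by rewrite addr_gt0.
apply: measurable_funD.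
  by apply: measurableT_comp; [exact: measurable_bc|exact: measurable_funX].
apply: measurable_funM => //.
by apply: measurableT_comp; [exact: measurable_bc|exact: measurable_funX].
Qed.

End DunklKernel.

(** * Rodrigues' formula *)

Section Rodrigues.
Context {R : realType}.
Implicit Types (a b x y : R) (m n N : nat).

Lemma is_derive_bigsum n (h : 'I_n -> R -> R) (dh : 'I_n -> R) (x : R) :
  (forall i, is_derive x (1 : R) (h i) (dh i)) ->
  is_derive x (1 : R) (fun y => \sum_(i < n) h i y) (\sum_(i < n) dh i).
Proof.
move=> dhi; have := is_derive_sum dhi.
by congr is_derive; apply/funext => y; rewrite fct_sumE.
Qed.

Lemma is_derive_oppX n x : is_derive x (1 : R) (fun y : R => (- y) ^+ n)
  (- (n%:R * (- x) ^+ n.-1)).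
Proof.
have dN := is_derive_scale (-1) (is_derive_id x (1 : R)).
have := is_derive1_comp (is_derive_exprn n (-1 * x)) dN.
have -> : (fun y : R => y ^+ n) \o (fun y => -1 * id y) = (fun y => (- y) ^+ n).
  by apply/funext => y; rewrite /= mulN1r.
by rewrite mulN1r mulr1 mulrN1.
Qed.

Lemma is_derive_lag b n y : is_derive y (1 : R) (lag b n)
  (\sum_(i < n.+1) 'C(n, i)%:R * (Gamma (n%:R + b) / Gamma (i%:R + b)) *
     - (i%:R * (- y) ^+ i.-1)).
Proof.
apply: is_derive_bigsum => i.
exact: is_derive_scale (is_derive_oppX i y).
Qed.

Lemma continuous_lag b n : continuous (@lag R b n).
Proof.
move=> y; apply: differentiable_continuous; apply/derivable1_diffP.
by have [] := is_derive_lag b n y.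
Qed.

(** This is the relation behind [(y^b e^{-y} L_n^(b))' = (n + 1) y^(b-1) e^{-y}
    L_(n+1)^(b-1)]. *)
Lemma lag_raise b n y : 0 < b ->
  b * lag (b + 1) n y - y * lag (b + 1) n y + y * 'D_1 (lag (b + 1) n) y = lag b n.+1 y.
Proof.
move=> b0; have [_ ->] := is_derive_lag (b + 1) n y.
have -> : y * \sum_(i < n.+1) 'C(n, i)%:R * (Gamma (n%:R + (b + 1)) / Gamma (i%:R + (b + 1))) *
     - (i%:R * (- y) ^+ i.-1) =
  \sum_(i < n.+1) 'C(n, i)%:R * (Gamma (n%:R + (b + 1)) / Gamma (i%:R + (b + 1))) *
     (i%:R * (- y) ^+ i).
  rewrite mulr_sumr; apply: eq_bigr => i _; rewrite mulrCA; congr (_ * _).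
  by case: (i : nat) => [|j]; rewrite ?mul0r ?oppr0 ?mulr0// exprS; ring.
rewrite /lag addrAC -mulNr !mulr_sumr -big_split/=.
rewrite [RHS]big_ord_recl bin0 mul1r expr0 mulr1.
under [X in _ = _ + X]eq_bigr => i _ do rewrite lift0 binS natrD 2!mulrDl.
rewrite [X in _ = _ + X]big_split/= [RHS]addrA; congr (_ + _); last first.
  apply: eq_bigr => i _; rewrite !Gamma_shift1 exprS.
  by move: (Gamma _ / Gamma _) => g; ring.
have e i : b * ('C(n, i)%:R * (Gamma (n%:R + (b + 1)) / Gamma (i%:R + (b + 1))) * (- y) ^+ i) +
   'C(n, i)%:R * (Gamma (n%:R + (b + 1)) / Gamma (i%:R + (b + 1))) * (i%:R * (- y) ^+ i) =
   'C(n, i)%:R * (Gamma (n.+1%:R + b) / Gamma (i%:R + b)) * (- y) ^+ i.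
  rewrite -!Gamma_shift1 (Gamma_shiftS i b0).
  have := Gamma_shift_gt0 i b0; have : 0 < i%:R + b by rewrite ltr_wpDl.
  move: (Gamma (i%:R + b)) (Gamma _) (i%:R) => g h j j0 g0.
  by field; rewrite !gt_eqF.
under eq_bigr => i _ do rewrite e.
rewrite big_ord_recl bin0 mul1r expr0 mulr1; congr (_ + _).
rewrite [RHS]big_ord_recr/= bin_small// !mul0r addr0.
by apply: eq_bigr.
Qed.

Lemma near_pos (y : R) : 0 < y -> \forall z \near y, 0 < z.
Proof. exact: lt_nbhsr. Qed.

(** The induction leaves [b] free: one more derivative lowers the exponent of
    [y] by one, so the hypothesis is used at [b + 1]. *)
Lemma rodrigues_derive b n y : 0 < b -> 0 < y ->
  derive1n n (fun u : R => u `^ (n%:R + (b - 1)) * expR (- u)) y =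
  laplace_power b 1 y * lag b n y.
Proof.
elim: n b y => [|n ih] b y b0 y0.
  rewrite derive1n0 /lag big_ord1 bin0 expr0 add0r mul1r mulr1 /laplace_power mulN1r.
  by rewrite divff ?mulr1// gt_eqF// Gamma_gt0// add0r.
have b1 : 0 < b + 1 by rewrite addr_gt0.
rewrite derive1nS derive1E.
rewrite (@near_eq_derive _ _ _ _ (fun z => laplace_power (b + 1) 1 z * lag (b + 1) n z)); last first.
  near=> z; rewrite -ih//; last by near: z; exact: near_pos.
  congr (derive1n _ _ _); apply/funext => u; congr (_ `^ _ * _).
  by rewrite -natr1; ring.
have dl := is_derive_laplace_power (b + 1) 1 y0.
have dP := is_derive_mul dl (is_derive_lag (b + 1) n y).
have [_ ->] := dP.
have [_ <-] := is_derive_lag (b + 1) n y.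
rewrite -lag_raise// addrK mul1r.
have -> : laplace_power (b + 1) 1 y = laplace_power b 1 y * y.
  by rewrite -[y in RHS]expr1 laplace_power_exprn// addrC.
by ring.
Unshelve. all: by end_near. Qed.

Lemma rodriguesE b n y : 0 < b -> 0 < y -> rodrigues n (b - 1) y = lag b n y / n`!%:R.
Proof.
move=> b0 y0; rewrite /rodrigues rodrigues_derive// /laplace_power powRN mulN1r.
rewrite expRN.
have := expR_gt0 y; have := powR_gt0 (b - 1) y0; have := @factr_gt0 R n.
move: (expR y) (y `^ _) (n`!%:R) => e p f f0 p0 e0.
by field; rewrite !gt_eqF.
Qed.

Lemma laguerreE b n y : 0 < b -> 0 <= y -> laguerre n (b - 1) y = lag b n y / n`!%:R.
Proof.
move=> b0; rewrite le_eqVlt => /predU1P[<-|y0]; last first.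
  by rewrite /laguerre gt_eqF// rodriguesE.
rewrite /laguerre eqxx; apply/cvg_lim => //.
have c : lag b n u / n`!%:R @[u --> (0 : R)^'+] --> lag b n 0 / n`!%:R.
  apply: cvg_at_right_filter; apply: cvgMl; exact: continuous_lag.
apply: cvg_trans c; apply: near_eq_cvg; near=> u.
by rewrite rodriguesE//; near: u; exact: nbhs_right_gt.
Unshelve. all: by end_near. Qed.

End Rodrigues.

(** * Mehler's formula for the Dunkl-Hermite functions *)

Section Mehler.
Context {R : realType}.
Variables (k : R).
Hypothesis k0 : 0 <= k.
Implicit Types (r x y : R) (m n N : nat).

Local Notation b := (k + 1 / 2).

Let b0 : 0 < b. Proof. by rewrite ltr_wpDl. Qed.
Let b1 : 0 < b + 1. Proof. by rewrite addr_gt0. Qed.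
Let b2 : 2^-1 <= b. Proof. by rewrite mul1r lerDr. Qed.

Lemma dunkl_hermite_even m x : dunkl_hermite k m.*2 x =
  expR (- x ^+ 2 / 2) * ((-1) ^+ m * Num.sqrt (m`!%:R / Gamma (m%:R + b))) *
  (lag b m (x ^+ 2) / m`!%:R).
Proof.
rewrite /dunkl_hermite /dunkl_hermite_poly odd_double doubleK -laguerreE ?sqr_ge0//.
have -> : m%:R + k + 1 / 2 = m%:R + b by rewrite addrA.
have -> : k - 1 / 2 = b - 1 by field.
by rewrite !mulrA.
Qed.

Lemma dunkl_hermite_odd m x : dunkl_hermite k m.*2.+1 x =
  expR (- x ^+ 2 / 2) * ((-1) ^+ m * Num.sqrt (m`!%:R / Gamma (m%:R + (b + 1)))) *
  x * (lag (b + 1) m (x ^+ 2) / m`!%:R).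
Proof.
rewrite /dunkl_hermite /dunkl_hermite_poly/= odd_double/= uphalf_double -laguerreE ?sqr_ge0//.
have -> : m%:R + k + 3 / 2 = m%:R + (b + 1) by field.
by rewrite addrK !mulrA.
Qed.

Lemma measurable_dunkl_hermite n : measurable_fun [set: R] (dunkl_hermite k n).
Proof.
have mg : measurable_fun [set: R] (fun x : R => expR (- x ^+ 2 / 2)).
  apply: measurableT_comp => //; apply: measurable_funM => //.
  by apply: measurableT_comp => //; exact: measurable_funX.
have ml (c : R) m : measurable_fun [set: R] (fun x : R => lag c m (x ^+ 2)).
  apply: measurableT_comp; last exact: measurable_funX.
  exact: continuous_measurable_fun (@continuous_lag R c m).
rewrite -(odd_double_half n); case: (odd n).
  rewrite add1n (funext (dunkl_hermite_odd _)).
  by apply: measurable_funM; [apply: measurable_funM => //; exact: measurable_funM|exact: measurable_funM].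
rewrite add0n (funext (dunkl_hermite_even _)).
by apply: measurable_funM; exact: measurable_funM.
Qed.

Let sign_sqrt_sqr m (c : R) : 0 < c ->
  ((-1) ^+ m * Num.sqrt (m`!%:R / c)) * ((-1) ^+ m * Num.sqrt (m`!%:R / c)) / m`!%:R / m`!%:R =
  (m`!%:R * c)^-1.
Proof.
move=> c0; rewrite mulrACA -expr2 sqrr_sign mul1r -expr2 sqr_sqrtr ?divr_ge0 ?ltW//.
have := @factr_gt0 R m; move: (m`!%:R) => f f0.
by field; rewrite !gt_eqF.
Qed.

Lemma dunkl_hermiteM_even m x y : dunkl_hermite k m.*2 x * dunkl_hermite k m.*2 y =
  expR (- (x ^+ 2 + y ^+ 2) / 2) *
  (lag b m (x ^+ 2) * lag b m (y ^+ 2) * bc_coef b m).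
Proof.
rewrite !dunkl_hermite_even /bc_coef -(@sign_sqrt_sqr m); last exact: Gamma_shift_gt0.
have -> : - (x ^+ 2 + y ^+ 2) / 2 = - x ^+ 2 / 2 + - y ^+ 2 / 2 by field.
by rewrite expRD; ring.
Qed.

Lemma dunkl_hermiteM_odd m x y : dunkl_hermite k m.*2.+1 x * dunkl_hermite k m.*2.+1 y =
  expR (- (x ^+ 2 + y ^+ 2) / 2) * (x * y) *
  (lag (b + 1) m (x ^+ 2) * lag (b + 1) m (y ^+ 2) * bc_coef (b + 1) m).
Proof.
rewrite !dunkl_hermite_odd /bc_coef -(@sign_sqrt_sqr m); last exact: Gamma_shift_gt0.
have -> : - (x ^+ 2 + y ^+ 2) / 2 = - x ^+ 2 / 2 + - y ^+ 2 / 2 by field.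
by rewrite expRD; ring.
Qed.

Definition mehler r x y : R := (1 - r ^+ 2) `^ (- b) *
  expR (- ((x ^+ 2 + y ^+ 2) / 2 * ((1 + r ^+ 2) / (1 - r ^+ 2)))) *
  dunkl_kernel b (x * y * r / (1 - r ^+ 2)).

Definition mehler_term r x y n := r ^+ n * (dunkl_hermite k n x * dunkl_hermite k n y).

Section FixedR.
Variable r : R.
Hypotheses (r0 : 0 < r) (r1 : r < 1).

Let s0 : 0 < r ^+ 2. Proof. exact: exprn_gt0. Qed.
Let s1 : r ^+ 2 < 1. Proof. by rewrite expr_lt1// ltW. Qed.
Let s10 : 0 < 1 - r ^+ 2. Proof. by rewrite subr_gt0. Qed.

(** The even and the odd terms are two Hille-Hardy series in [r^2], at the points
    [x^2] and [y^2]. *)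
Lemma mehlerE x y : series (mehler_term r x y) @ \oo --> mehler r x y.
Proof.
pose L0 := expR (- (x ^+ 2 + y ^+ 2) / 2) * ((1 - r ^+ 2) `^ (- b) *
    expR (- ((x ^+ 2 + y ^+ 2) * (r ^+ 2 / (1 - r ^+ 2)))) *
    bessel_clifford b (x ^+ 2 * y ^+ 2 * r ^+ 2 / (1 - r ^+ 2) ^+ 2)).
pose L1 := expR (- (x ^+ 2 + y ^+ 2) / 2) * (x * y) * r * ((1 - r ^+ 2) `^ (- (b + 1)) *
    expR (- ((x ^+ 2 + y ^+ 2) * (r ^+ 2 / (1 - r ^+ 2)))) *
    bessel_clifford (b + 1) (x ^+ 2 * y ^+ 2 * r ^+ 2 / (1 - r ^+ 2) ^+ 2)).
have he : series (fun m => mehler_term r x y m.*2) @ \oo --> L0.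
  rewrite (_ : (fun m => _) = (fun m => expR (- (x ^+ 2 + y ^+ 2) / 2) *
     ((r ^+ 2) ^+ m * lag b m (x ^+ 2) * lag b m (y ^+ 2) * bc_coef b m))).
    by apply: cvg_seriesMl; exact: hille_hardy.
  apply/funext => m; rewrite /mehler_term dunkl_hermiteM_even -exprM mul2n.
  by ring.
have ho : series (fun m => mehler_term r x y m.*2.+1) @ \oo --> L1.
  rewrite (_ : (fun m => _) = (fun m => expR (- (x ^+ 2 + y ^+ 2) / 2) * (x * y) * r *
     ((r ^+ 2) ^+ m * lag (b + 1) m (x ^+ 2) * lag (b + 1) m (y ^+ 2) * bc_coef (b + 1) m))).
    by apply: cvg_seriesMl; exact: hille_hardy.
  apply/funext => m; rewrite /mehler_term dunkl_hermiteM_odd -exprM mul2n exprS.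
  by ring.
have -> : series (mehler_term r x y) = (fun N =>
    series (fun m => mehler_term r x y m.*2) (uphalf N) +
    series (fun m => mehler_term r x y m.*2.+1) N./2).
  by apply/funext => N; exact: series_even_odd.
have cu : uphalf n @[n --> \oo] --> \oo.
  by have := cvg_half; rewrite -(cvg_shiftS half).
suff <- : L0 + L1 = mehler r x y.
  by apply: cvgD; [exact: (cvg_comp _ _ cu he)|exact: (cvg_comp _ _ cvg_half ho)].
rewrite /L0 /L1 /mehler /dunkl_kernel.
have -> : - ((x ^+ 2 + y ^+ 2) / 2 * ((1 + r ^+ 2) / (1 - r ^+ 2))) =
  - (x ^+ 2 + y ^+ 2) / 2 + - ((x ^+ 2 + y ^+ 2) * (r ^+ 2 / (1 - r ^+ 2))).
  by field; rewrite gt_eqF.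
have -> : (x * y * r / (1 - r ^+ 2)) ^+ 2 = x ^+ 2 * y ^+ 2 * r ^+ 2 / (1 - r ^+ 2) ^+ 2.
  by field; rewrite gt_eqF.
rewrite expRD (opprD b 1) powRD_gt0// powR_inv1 ?(ltW s10)//.
move: (bessel_clifford b _) (bessel_clifford (b + 1) _) (_ `^ _) (1 - r ^+ 2)^-1.
move: (expR (- (x ^+ 2 + y ^+ 2) / 2)) (expR _) => e1 e2 B0 B1 p q.
by ring.
Qed.

Lemma mehler_ge0 x y : 0 <= mehler r x y.
Proof. by rewrite /mehler mulr_ge0 ?mulr_ge0 ?powR_ge0 ?expR_ge0 ?dunkl_kernel_ge0. Qed.

(** Half of the decay rate [(1 - r) / (1 + r)] of the diagonal of the kernel. *)
Definition mehler_rate : R := (1 - r) / (2 * (1 + r)).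

Lemma mehler_rate_gt0 : 0 < mehler_rate.
Proof. by rewrite divr_gt0 ?subr_gt0// mulr_gt0// addr_gt0. Qed.

Definition mehler_cst : R := (1 - r ^+ 2) `^ (- b) / Gamma b.

Lemma mehler_cst_ge0 : 0 <= mehler_cst.
Proof. by rewrite divr_ge0 ?powR_ge0// ltW// Gamma_gt0. Qed.

Lemma mehler_diag_le y : mehler r y y <= mehler_cst * expR (- (2 * mehler_rate * y ^+ 2)).
Proof.
have h : dunkl_kernel b (y * y * r / (1 - r ^+ 2)) <=
    (Gamma b)^-1 * expR (2 * (y * y * r / (1 - r ^+ 2))).
  apply: dunkl_kernel_le => //.
  by rewrite divr_ge0 ?(ltW s10)// mulr_ge0 ?(ltW r0)// -expr2 sqr_ge0.
apply: (le_trans (ler_wpM2l _ h)); first by rewrite mulr_ge0 ?powR_ge0 ?expR_ge0.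
rewrite le_eqVlt; apply/orP; left; apply/eqP.
have -> : - (2 * mehler_rate * y ^+ 2) = - ((y ^+ 2 + y ^+ 2) / 2 * ((1 + r ^+ 2) / (1 - r ^+ 2)))
  + 2 * (y * y * r / (1 - r ^+ 2)).
  have rr : 1 - r ^+ 2 = (1 - r) * (1 + r) by ring.
  have n1 : 1 - r != 0 by rewrite gt_eqF// subr_gt0.
  have n2 : 1 + r != 0 by rewrite gt_eqF// addr_gt0.
  by rewrite /mehler_rate rr; field; rewrite n1 n2.
by rewrite expRD /mehler_cst; ring.
Qed.

Lemma mehler_term_diag_ge0 y n : 0 <= mehler_term r y y n.
Proof. by rewrite /mehler_term mulr_ge0 ?exprn_ge0 ?(ltW r0)// -expr2 sqr_ge0. Qed.

Lemma mehler_diag_series_le y N : series (mehler_term r y y) N <= mehler r y y.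
Proof.
rewrite -(cvg_lim _ (@mehlerE y y))//; apply: series_le_limn.
  exact: mehler_term_diag_ge0.
by apply/cvg_ex; eexists; exact: mehlerE.
Qed.

Lemma dunkl_hermite_sqr_le y n :
  r ^+ n * dunkl_hermite k n y ^+ 2 <= mehler_cst * expR (- (2 * mehler_rate * y ^+ 2)).
Proof.
apply: le_trans (mehler_diag_le y); apply: le_trans (mehler_diag_series_le y n.+1).
rewrite seriesSr expr2 lerDr; apply: sumr_ge0 => i _; exact: mehler_term_diag_ge0.
Qed.

(** Arithmetic-geometric mean inequality with weights [expR (- c y^2)] on
    [h_n(x)^2] and [expR (c y^2)] on [h_n(y)^2], where [c] is [mehler_rate]: half
    of the decay of the diagonal at [y] survives. *)
Lemma mehler_norm_series_le x y N : series (fun n => `|mehler_term r x y n|) N <=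
  (mehler r x x + mehler_cst) * expR (- (mehler_rate * y ^+ 2)).
Proof.
set l := expR (- (mehler_rate * y ^+ 2)).
have l0 : 0 < l by exact: expR_gt0.
have ll : l^-1 * expR (- (2 * mehler_rate * y ^+ 2)) = l.
  by rewrite /l -expRN -expRD; congr expR; ring.
apply: (@le_trans _ _ (l * series (mehler_term r x x) N + l^-1 * series (mehler_term r y y) N)).
  rewrite /series/= !mulr_sumr -big_split/=; apply: ler_sum => n _.
  rewrite /mehler_term normrM (ger0_norm (exprn_ge0 _ (ltW r0))) !(mulrCA _ (r ^+ n)) -mulrDr.
  rewrite ler_wpM2l ?exprn_ge0 ?(ltW r0)// normrM.
  set A := dunkl_hermite k n x; set B := dunkl_hermite k n y.
  rewrite -!expr2 -[A ^+ 2]real_normK ?num_real// -[B ^+ 2]real_normK ?num_real//.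
  have : 0 <= l^-1 * (l * `|A| - `|B|) ^+ 2 by rewrite mulr_ge0 ?sqr_ge0// invr_ge0 ltW.
  have -> : l^-1 * (l * `|A| - `|B|) ^+ 2 = l * `|A| ^+ 2 + l^-1 * `|B| ^+ 2 - 2 * (`|A| * `|B|).
    by field; rewrite gt_eqF.
  rewrite subr_ge0; apply: le_trans.
  by rewrite ler_peMl ?mulr_ge0// ler1n.
rewrite mulrDl; apply: lerD.
  by rewrite mulrC ler_wpM2r ?(ltW l0)// mehler_diag_series_le.
apply: (@le_trans _ _ (l^-1 * mehler r y y)).
  by rewrite ler_wpM2l ?invr_ge0 ?(ltW l0)// mehler_diag_series_le.
apply: (le_trans (ler_wpM2l _ (mehler_diag_le y))); first by rewrite invr_ge0 ltW.
by rewrite mulrCA ll.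
Qed.

End FixedR.

End Mehler.

(** * Integrals against the weight *)

Section Weight.
Context {R : realType}.
Variable k : R.
Hypothesis k0 : 0 <= k.
Implicit Types (d r x y : R) (m n N : nat) (f : R -> R).

Notation mu := (@lebesgue_measure R).
Notation pos := (`]0%R, +oo[%classic : set R).
Local Notation b := (k + 1 / 2).

Let b0 : 0 < b. Proof. by rewrite ltr_wpDl. Qed.
Let b1 : 0 < b + 1. Proof. by rewrite addr_gt0. Qed.

Lemma nneseries_EFin (u : nat -> R) (l : R) : series u @ \oo --> l ->
  (\sum_(n <oo) (u n)%:E = l%:E)%E.
Proof.
move=> cu; apply/cvg_lim => //.
rewrite (_ : (fun _ => _) = (EFin \o series u)).
  by apply: cvg_EFin => //; exact: nearW.
by apply/funext => n; rewrite /= /series/= sumEFin.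
Qed.

Lemma integralT_fold f : continuous f -> (forall x, 0 <= f x) ->
  (\int[mu]_x (f x)%:E = \int[mu]_(x in pos) (f x + f (- x))%:E)%E.
Proof.
move=> cf f0.
have mf : measurable_fun [set: R] f by exact: continuous_measurable_fun.
have mfN : measurable_fun [set: R] (fun x => f (- x)) by exact: measurableT_comp.
have -> : [set: R] = `]-oo, (- 0)%R]%classic `|` pos.
  by rewrite oppr0 -setCitvr setUC setUv.
rewrite ge0_integral_setU//=; last 3 first.
- by apply/measurable_EFinP; exact: measurable_funS mf.
- by move=> x _; rewrite lee_fin.
- rewrite oppr0; apply/disj_setPS => x /=.
  by rewrite !in_itv/= andbT => -[] /le_lt_trans h /h; rewrite ltxx.
rewrite ge0_integration_by_substitutionNy; last 2 first.
- exact: continuous_subspaceT.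
- by move=> x _; exact: f0.
rewrite -integral_itv_obnd_cbnd; last first.
  by apply/measurable_EFinP; exact: measurable_funS mfN.
under [RHS]eq_integral do rewrite EFinD.
rewrite ge0_integralD//=; last 4 first.
- by move=> x _; rewrite lee_fin.
- by apply/measurable_EFinP; exact: measurable_funS mf.
- by move=> x _; rewrite lee_fin.
- by apply/measurable_EFinP; exact: measurable_funS mfN.
by rewrite addeC.
Qed.

Definition weight y : R := `|y| `^ (2 * k).

Lemma weight_ge0 y : 0 <= weight y.
Proof. exact: powR_ge0. Qed.

Lemma weightN y : weight (- y) = weight y.
Proof. by rewrite /weight normrN. Qed.

Lemma weight_gt0E y : 0 < y -> weight y = y `^ (2 * b - 1).
Proof.
move=> y0; rewrite /weight gtr0_norm//; congr powR; by field.
Qed.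

(** The case [k = 0] is separate because [0 `^ 0 = 1]. *)
Lemma continuous_weight : continuous weight.
Proof.
move=> y; rewrite /weight; have [->|kn0] := eqVneq k 0.
  rewrite mulr0 (_ : (fun y => _) = cst 1); first exact: cvg_cst.
  by apply/funext => z; rewrite powRr0.
have kp : 0 < 2 * k by rewrite mulr_gt0// lt_neqAle eq_sym kn0.
have [->|yn0] := eqVneq y 0.
  rewrite /continuous_at normr0 powR0 ?gt_eqF//.
  apply/cvgr0Pnorm_lt => e e0; near=> z.
  have eE : e = (e `^ (2 * k)^-1) `^ (2 * k).
    by rewrite -powRrM mulVf ?gt_eqF// powRr1// ltW.
  rewrite ger0_norm ?powR_ge0// [ltRHS]eE gt0_ltr_powR ?nnegrE ?powR_ge0//.
  near: z; have : 0 < e `^ (2 * k)^-1 by exact: powR_gt0.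
  by move=> ee; have /cvgr0Pnorm_lt := (@cvg_id _ (nbhs (0 : R))); exact.
have y0 : 0 < `|y| by rewrite normr_gt0.
have h : {for `|y|, continuous (fun z : R => z `^ (2 * k))}.
  apply: differentiable_continuous; apply/derivable1_diffP.
  by have [] := is_derive1_powR (2 * k) y0.
exact: (cvg_comp _ _ (@norm_continuous _ _ y) h).
Unshelve. all: by end_near. Qed.

Lemma measurable_weight : measurable_fun [set: R] weight.
Proof. exact: continuous_measurable_fun continuous_weight. Qed.

Lemma continuous_gaussian d : continuous (fun y : R => expR (- (d * y ^+ 2))).
Proof.
move=> y; apply: continuous_comp; last exact: continuous_expR.
apply: cvgN; apply: cvgMr; exact: exprn_continuous.
Qed.

Lemma gaussian_weight_lty d : 0 < d ->
  (\int[mu]_y (expR (- (d * y ^+ 2)) * weight y)%:E < +oo)%E.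
Proof.
move=> d0; rewrite integralT_fold; last 2 first.
- by move=> y; apply: cvgM; [exact: continuous_gaussian|exact: continuous_weight].
- by move=> y; rewrite mulr_ge0 ?expR_ge0 ?weight_ge0.
rewrite (_ : (\int[mu]_(y in pos) _ = \int[mu]_(y in pos) (2%:E *
  (y `^ (2 * b - 1) * expR (- d * y ^+ 2))%:E))%E); last first.
  apply: eq_integral => y; rewrite inE/= in_itv/= andbT => y0.
  rewrite weightN sqrrN -EFinM weight_gt0E// mulNr; congr EFin; ring.
rewrite ge0_integralZl_EFin//=.
- by rewrite integral_gaussian_moment// -EFinM ltry.
- by move=> y _; rewrite lee_fin mulr_ge0 ?powR_ge0 ?expR_ge0.
- apply/measurable_EFinP; apply: (@measurable_funS _ _ _ _ setT) => //.
  apply: measurable_funM; first exact: measurable_powR.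
  by apply: measurableT_comp => //; apply: measurable_funM => //; exact: measurable_funX.
Qed.

Lemma mehlerC r x y : mehler k r x y = mehler k r y x.
Proof. by rewrite /mehler (addrC (x ^+ 2)) (mulrC x y). Qed.

Lemma continuous_dunkl_kernel (z : R) : {for z, continuous (@dunkl_kernel R b)}.
Proof.
apply: cvgD.
  by apply: continuous_comp; [exact: exprn_continuous|exact: continuous_bc].
apply: cvgM; first exact: cvg_id.
by apply: continuous_comp; [exact: exprn_continuous|exact: continuous_bc].
Qed.

Section FixedR.
Variable r : R.
Hypotheses (r0 : 0 < r) (r1 : r < 1).

Let s1 : r ^+ 2 < 1. Proof. by rewrite expr_lt1// ltW. Qed.
Let s10 : 0 < 1 - r ^+ 2. Proof. by rewrite subr_gt0. Qed.
Let sp : 0 < 1 + r ^+ 2. Proof. by rewrite addr_gt0// exprn_gt0. Qed.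

Lemma continuous_mehler x : continuous (mehler k r x).
Proof.
move=> y; apply: cvgM.
  apply: cvgMr; apply: continuous_comp; last exact: continuous_expR.
  apply: cvgN; apply: cvgMl; apply: cvgMl; apply: cvgD; first exact: cvg_cst.
  exact: exprn_continuous.
apply: (@continuous_comp _ _ _ (fun y => x * y * r / (1 - r ^+ 2)) (dunkl_kernel b));
  last exact: continuous_dunkl_kernel.
apply: cvgMl; apply: cvgMl; apply: cvgMr; exact: cvg_id.
Qed.

Let kappa : R := (1 + r ^+ 2) / (1 - r ^+ 2).
Let kappa0 : 0 < kappa / 2. Proof. by rewrite !divr_gt0. Qed.
Let q x : R := (x * r / (1 - r ^+ 2)) ^+ 2.

Definition mehler_mass : R := ((1 + r ^+ 2) / 2) `^ (- b).

Lemma mehler_mass_gt0 : 0 < mehler_mass.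
Proof. by rewrite powR_gt0// divr_gt0. Qed.

(** The odd part of the kernel integrates to zero and the even part is a
    Gaussian mixture of monomials, so the row sums are computed term by term. *)
Lemma mehler_row_le x :
  (\int[mu]_y (mehler k r x y * weight y)%:E <= mehler_mass%:E)%E.
Proof.
rewrite integralT_fold; last 2 first.
- by move=> y; apply: cvgM; [exact: continuous_mehler|exact: continuous_weight].
- by move=> y; rewrite mulr_ge0 ?mehler_ge0 ?weight_ge0.
pose A : R := (1 - r ^+ 2) `^ (- b) * expR (- (x ^+ 2 * (kappa / 2))).
have A0 : 0 <= A by rewrite mulr_ge0 ?powR_ge0 ?expR_ge0.
pose T m (y : R) := 2 * A * bc_coef b m * q x ^+ m *
  (y `^ (2 * (m%:R + b) - 1) * expR (- (kappa / 2) * y ^+ 2)).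
have c0 m : 0 <= 2 * A * bc_coef b m * q x ^+ m.
  have q0 : 0 <= q x by exact: sqr_ge0.
  apply: mulr_ge0; last exact: exprn_ge0.
  by apply: mulr_ge0; [exact: mulr_ge0|exact: bc_coef_ge0].
have T0 m y : 0 <= T m y by rewrite mulr_ge0// mulr_ge0 ?powR_ge0 ?expR_ge0.
have mg m : measurable_fun pos (fun y : R => y `^ (2 * (m%:R + b) - 1) * expR (- (kappa / 2) * y ^+ 2)).
  apply: (@measurable_funS _ _ _ _ setT) => //.
  apply: measurable_funM; first exact: measurable_powR.
  by apply: measurableT_comp => //; apply: measurable_funM => //; exact: measurable_funX.
have ET y : 0 < y -> series (T ^~ y) @ \oo -->
    mehler k r x y * weight y + mehler k r x (- y) * weight (- y).
  move=> y0.
  have -> : mehler k r x y * weight y + mehler k r x (- y) * weight (- y) =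
      2 * A * expR (- (kappa / 2) * y ^+ 2) * y `^ (2 * b - 1) *
      bessel_clifford b (q x * y ^+ 2).
    rewrite weightN weight_gt0E// /mehler /dunkl_kernel !mulrN !mulNr !sqrrN.
    have -> : (x * y * r / (1 - r ^+ 2)) ^+ 2 = q x * y ^+ 2.
      by rewrite /q; field; rewrite gt_eqF.
    have -> : - ((x ^+ 2 + y ^+ 2) / 2 * ((1 + r ^+ 2) / (1 - r ^+ 2))) =
      - (x ^+ 2 * (kappa / 2)) + - (kappa / 2) * y ^+ 2.
      by rewrite /kappa; field; rewrite gt_eqF.
    rewrite expRD /A (mulNr (kappa / 2)).
    move: (bessel_clifford b _) (bessel_clifford (b + 1) _) (expR _) (expR _) (_ `^ _) (_ `^ _).
    by move=> *; ring.
  have -> : T ^~ y = (fun m => 2 * A * expR (- (kappa / 2) * y ^+ 2) * y `^ (2 * b - 1) *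
      (bc_coef b m * (q x * y ^+ 2) ^+ m)).
    apply/funext => m; rewrite /T.
    have -> : 2 * (m%:R + b) - 1 = (2 * m)%:R + (2 * b - 1) by rewrite natrM; ring.
    rewrite powRD_gt0// powR_mulrn ?(ltW y0)// exprM (exprMn m (q x)).
    by move: ((y ^+ 2) ^+ m) (q x ^+ m) (_ `^ _) (expR _) (bc_coef _ _) => *; ring.
  by apply: cvg_seriesMl; exact: bc_cvg.
have -> : (\int[mu]_(y in pos) (mehler k r x y * weight y + mehler k r x (- y) * weight (- y))%:E =
    \int[mu]_(y in pos) (\sum_(m <oo) (T m y)%:E))%E.
  apply: eq_integral => y; rewrite inE/= in_itv/= andbT => y0.
  by rewrite (nneseries_EFin (ET y y0)).
rewrite integral_nneseries//=; last 2 first.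
- move=> m; apply/measurable_EFinP; apply: measurable_funM => //; exact: mg.
- by move=> m y _; rewrite lee_fin.
have eT m : (\int[mu]_(y in pos) (T m y)%:E =
    (A * (kappa / 2) `^ (- b) * exp_coeff (q x / (kappa / 2)) m)%:E)%E.
  rewrite /T.
  have mb0 : 0 < m%:R + b by rewrite ltr_wpDl.
  under eq_integral do rewrite EFinM.
  rewrite ge0_integralZl_EFin//=; last 2 first.
  - by move=> y _; rewrite lee_fin mulr_ge0 ?powR_ge0 ?expR_ge0.
  - by apply/measurable_EFinP; exact: mg.
  rewrite integral_gaussian_moment// -EFinM; congr EFin.
  rewrite opprD powRD_gt0// [X in _ * (_ * (X * _))]powRN powR_mulrn ?(ltW kappa0)//.
  rewrite /bc_coef /exp_coeff/= [(q x / _) ^+ m]expr_div_n.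
  have := Gamma_shift_gt0 m b0; have := @factr_gt0 R m; have := exprn_gt0 m kappa0.
  move: (Gamma _) (m`!%:R) ((kappa / 2) ^+ m) (q x ^+ m) (_ `^ _) => g f kk qq B kk0 f0 g0.
  by field; rewrite !gt_eqF.
under eq_eseriesr do rewrite eT.
have cE := cvg_seriesMl (c := A * (kappa / 2) `^ (- b)) (is_cvg_series_exp_coeff (q x / (kappa / 2))).
rewrite (nneseries_EFin cE) lee_fin -/(expR (q x / (kappa / 2))).
have -> : A * (kappa / 2) `^ (- b) * expR (q x / (kappa / 2)) =
  mehler_mass * expR (- (x ^+ 2 / 2 * ((1 - r ^+ 2) / (1 + r ^+ 2)))).
  have -> : mehler_mass = (1 - r ^+ 2) `^ (- b) * (kappa / 2) `^ (- b).
    rewrite -powRM ?(ltW s10) ?(ltW kappa0)//; congr powR.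
    by rewrite /kappa; field; rewrite gt_eqF.
  have -> : - (x ^+ 2 / 2 * ((1 - r ^+ 2) / (1 + r ^+ 2))) =
      - (x ^+ 2 * (kappa / 2)) + q x / (kappa / 2).
    by rewrite /q /kappa; field; rewrite !gt_eqF.
  by rewrite expRD /A; ring.
rewrite ler_piMr ?(ltW mehler_mass_gt0)// expR_le1 oppr_le0.
by rewrite mulr_ge0 ?divr_ge0 ?sqr_ge0 ?(ltW s10) ?(ltW sp).
Qed.

End FixedR.
End Weight.

(** * Contraction in the weighted Lebesgue spaces *)

Section Contraction.
Context {R : realType}.

Notation mu := (@lebesgue_measure R).

Lemma powR_inv (s x : R) : 0 < x -> x^-1 `^ s = x `^ (- s).
Proof. by move=> x0; rewrite -powR_inv1 ?(ltW x0)// -powRrM mulN1r. Qed.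

(** Tangent line of [v |-> v^p] at [v = a], scaled to be homogeneous. *)
Lemma le_powR_tangent (p a v : R) : 1 <= p -> 0 < a -> 0 <= v ->
  v <= a `^ (1 - p) / p * v `^ p + a * (1 - p^-1).
Proof.
move=> p1 a0 v0; have p0 : 0 < p by exact: lt_le_trans p1.
have [->|pn1] := eqVneq p 1.
  by rewrite subrr powRr0 invr1 mulr1 mul1r subrr mulr0 addr0 powRr1.
have pp : 1 < p by rewrite lt_neqAle eq_sym pn1.
have q0 : 0 < 1 - p^-1 by rewrite subr_gt0 invf_lt1.
have h := @conjugate_powR R (v / a) 1 p (1 - p^-1)^-1 _ ler01 p0.
have {h} : v / a * 1 <= (v / a) `^ p / p + 1 `^ (1 - p^-1)^-1 / (1 - p^-1)^-1.
  apply: h; rewrite ?invr_gt0//; first by rewrite divr_ge0// ltW.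
  by rewrite invrK addrC subrK.
rewrite mulr1 powR1 div1r invrK ler_pdivrMr// mulrDl => /le_trans; apply.
rewrite [X in _ + X]mulrC lerD2r powRM ?invr_ge0 ?(ltW a0)//.
rewrite -powR_inv1 ?(ltW a0)// -powRrM mulN1r (powRD_gt0 1 (- p) a0) powRr1 ?(ltW a0)//.
by rewrite le_eqVlt; apply/orP; left; apply/eqP; ring.
Qed.

Variables (k p : R) (f : R -> R).
Hypotheses (k0 : 0 <= k) (p1 : 1 <= p) (fp : in_Lp k p f).
Implicit Types (r t x y : R) (n N : nat).

Local Notation b := (k + 1 / 2).
Local Notation W := (weight k).

Let p0 : 0 < p. Proof. exact: lt_le_trans p1. Qed.
Let mf : measurable_fun [set: R] f. Proof. by case: fp. Qed.
Let mW : measurable_fun [set: R] W. Proof. exact: measurable_weight. Qed.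

Let mfp : measurable_fun [set: R] (fun y => `|f y| `^ p).
Proof.
apply: (@measurableT_comp _ _ _ _ _ _ (fun z : R => z `^ p)); first exact: measurable_powR.
exact: measurableT_comp.
Qed.

Local Notation Np := (\int[mu]_y (`|f y| `^ p * W y)%:E)%E.

Let Np_lty : (Np < +oo)%E.
Proof.
have [_] := fp; rewrite /Lp_norm; apply: lty_poweRy.
by rewrite invr_eq0 gt_eqF.
Qed.

(** Because [|f| <= 1 + |f|^p], and the Gaussian is bounded and integrable for
    the weight. *)
Lemma integrable_Lp_gaussian d : 0 < d -> mu.-integrable [set: R]
  (EFin \o (fun y => expR (- (d * y ^+ 2)) * (`|f y| * W y))).
Proof.
move=> d0.
have me : measurable_fun [set: R] (fun y : R => expR (- (d * y ^+ 2))).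
  exact: continuous_measurable_fun (@continuous_gaussian R d).
have mg : measurable_fun [set: R] (fun y : R => expR (- (d * y ^+ 2)) * (`|f y| * W y)).
  by apply: measurable_funM => //; apply: measurable_funM => //; exact: measurableT_comp.
apply/integrableP; split; first exact/measurable_EFinP.
apply: (@le_lt_trans _ _ (\int[mu]_y ((`|f y| `^ p * W y)%:E + (expR (- (d * y ^+ 2)) * W y)%:E))%E).
  apply: ge0_le_integral => //=.
  - by apply/measurable_EFinP; exact: measurableT_comp.
  - by apply: emeasurable_funD; apply/measurable_EFinP; exact: measurable_funM.
  - move=> y _; rewrite -EFinD lee_fin ger0_norm ?mulr_ge0 ?expR_ge0 ?weight_ge0//.
    rewrite mulrA -mulrDl ler_wpM2r ?weight_ge0//.
    have e1 : expR (- (d * y ^+ 2)) <= 1.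
      by rewrite expR_le1 oppr_le0 mulr_ge0 ?sqr_ge0// ltW.
    have [f1|f1] := leP 1 `|f y|.
      apply: (@le_trans _ _ `|f y|); first by rewrite ler_piMl.
      apply: (@le_trans _ _ (`|f y| `^ p)); first exact: le1r_powR.
      by rewrite lerDl expR_ge0.
    apply: (@le_trans _ _ (expR (- (d * y ^+ 2)))); first by rewrite ler_piMr ?expR_ge0// ltW.
    by rewrite lerDr powR_ge0.
rewrite ge0_integralD//=.
- by rewrite lte_add_pinfty// gaussian_weight_lty.
- by move=> y _; rewrite lee_fin mulr_ge0 ?powR_ge0.
- by apply/measurable_EFinP; exact: measurable_funM.
- by move=> y _; rewrite lee_fin mulr_ge0 ?expR_ge0 ?weight_ge0.
- by apply/measurable_EFinP; exact: measurable_funM.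
Qed.

Let m_integrand n : measurable_fun [set: R] (coef_integrand k f n).
Proof.
apply: measurable_funM => //; apply: measurable_funM => //.
exact: measurable_dunkl_hermite.
Qed.

Section FixedR.
Variable r : R.
Hypotheses (r0 : 0 < r) (r1 : r < 1).

Local Notation rate := (mehler_rate r).
Local Notation cst := (mehler_cst k r).
Local Notation M := (mehler_mass k r).

(** One term of the diagonal sum already has the Gaussian bound of the whole
    sum. *)
Lemma dunkl_hermite_gaussian n : exists2 C : R, 0 <= C &
  forall y, `|dunkl_hermite k n y| <= C * expR (- (rate * y ^+ 2)).
Proof.
have rn : 0 < r ^+ n by exact: exprn_gt0.
exists (Num.sqrt (cst / r ^+ n)); first exact: sqrtr_ge0.
move=> y; rewrite -ler_sqr ?nnegrE ?mulr_ge0 ?sqrtr_ge0 ?expR_ge0//.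
have q0 : 0 <= cst / r ^+ n by apply: divr_ge0; [exact: mehler_cst_ge0|exact: ltW].
rewrite exprMn sqr_sqrtr//.
rewrite real_normK ?num_real// -(ler_pM2l rn).
apply: (le_trans (dunkl_hermite_sqr_le k0 r0 r1 y n)).
have -> : expR (- (rate * y ^+ 2)) ^+ 2 = expR (- (2 * rate * y ^+ 2)).
  by rewrite expr2 -expRD; congr expR; ring.
rewrite le_eqVlt; apply/orP; left; apply/eqP.
by move: (r ^+ n) rn {q0} => q q0; field; rewrite gt_eqF.
Qed.

Lemma coef_integrandE n y :
  coef_integrand k f n y = f y * dunkl_hermite k n y * W y.
Proof. by []. Qed.

Lemma mehler_termM n x y : mehler_term k r x y n * (f y * W y) =
  r ^+ n * dunkl_hermite k n x * coef_integrand k f n y.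
Proof. by rewrite coef_integrandE /mehler_term; ring. Qed.

Lemma integrable_coef_integrand n :
  mu.-integrable [set: R] (EFin \o coef_integrand k f n).
Proof.
have [C C0 hC] := dunkl_hermite_gaussian n.
have iG := @integrable_scale _ _ R mu _ C _ measurableT
  (integrable_Lp_gaussian (mehler_rate_gt0 r0 r1)).
apply: le_integrable iG => //; first by apply/measurable_EFinP; exact: m_integrand.
move=> y _ /=; rewrite lee_fin.
rewrite [leRHS]ger0_norm; last by rewrite !mulr_ge0 ?expR_ge0 ?weight_ge0.
rewrite coef_integrandE 2!normrM (ger0_norm (weight_ge0 _ _)).
have -> : `|f y| * `|dunkl_hermite k n y| * W y =
  `|dunkl_hermite k n y| * (`|f y| * W y) by ring.
by rewrite [leRHS]mulrA ler_wpM2r// mulr_ge0// weight_ge0.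
Qed.

Let mK2 : measurable_fun [set: R * R] (fun z => mehler k r z.1 z.2).
Proof.
apply: measurable_funM.
  apply: measurable_funM => //; apply: measurableT_comp => //.
  apply: measurableT_comp => //; apply: measurable_funM => //; apply: measurable_funM => //.
  by apply: measurable_funD; apply: measurable_funX.
apply: measurableT_comp; first by apply: measurable_dunkl_kernel; rewrite ltr_wpDl.
apply: measurable_funM => //; apply: measurable_funM => //.
by apply: measurable_funM.
Qed.

Let mK x : measurable_fun [set: R] (mehler k r x).
Proof. by apply: continuous_measurable_fun; exact: continuous_mehler. Qed.

#[local] Opaque mehler weight.

Let K0 x y : 0 <= mehler k r x y. Proof. exact: mehler_ge0. Qed.
Let W0 y : 0 <= W y. Proof. exact: weight_ge0. Qed.
Let fW0 y : 0 <= `|f y| `^ p * W y. Proof. by rewrite mulr_ge0 ?powR_ge0. Qed.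
Let KW0 x y : 0 <= mehler k r x y * W y. Proof. by rewrite mulr_ge0. Qed.
Let KfW0 x y : 0 <= mehler k r x y * (`|f y| `^ p * W y). Proof. by rewrite mulr_ge0. Qed.

Let mKfp x : measurable_fun [set: R] (fun y => mehler k r x y * (`|f y| `^ p * W y)).
Proof. by apply: measurable_funM => //; exact: measurable_funM. Qed.

Let mKf x : measurable_fun [set: R] (fun y => mehler k r x y * (f y * W y)).
Proof. by apply: measurable_funM => //; exact: measurable_funM. Qed.

Let mKaf x : measurable_fun [set: R] (fun y => mehler k r x y * (`|f y| * W y)).
Proof.
by apply: measurable_funM => //; apply: measurable_funM => //; exact: measurableT_comp.
Qed.

Let mKW x : measurable_fun [set: R] (fun y => mehler k r x y * W y).
Proof. exact: measurable_funM. Qed.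

Let mfW : measurable_fun [set: R] (fun y => `|f y| `^ p * W y).
Proof. exact: measurable_funM. Qed.

Let normKf x y : `|mehler k r x y * (f y * W y)| = mehler k r x y * (`|f y| * W y).
Proof. by rewrite normrM (ger0_norm (K0 x y)) normrM (ger0_norm (W0 y)). Qed.

Definition mehler_transform x : R := \int[mu]_y (mehler k r x y * (f y * W y)).

Lemma mehler_transformE x : mu.-integrable [set: R]
    (EFin \o (fun y => mehler k r x y * (f y * W y))) /\
  series (fun n => r ^+ n * dunkl_hermite k n x * dunkl_hermite_coef k f n) @ \oo -->
  mehler_transform x.
Proof.
have C0 : 0 <= mehler k r x x + cst by rewrite addr_ge0 ?mehler_ge0 ?mehler_cst_ge0.
have [||||iG cI] := @cvg_series_Rintegral _ _ R mu [set: R]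
  (fun n y => mehler_term k r x y n * (f y * W y))
  (fun y => mehler k r x y * (f y * W y))
  (fun y => (mehler k r x x + cst) * (expR (- (rate * y ^+ 2)) * (`|f y| * W y))) measurableT.
- move=> n; apply: measurable_funM; last exact: measurable_funM.
  apply: measurable_funM => //; apply: measurable_funM => //.
  exact: measurable_dunkl_hermite.
- apply: integrable_scale => //; apply: integrable_Lp_gaussian.
  exact: mehler_rate_gt0.
- move=> y _.
  have -> : series (fun n => mehler_term k r x y n * (f y * W y)) =
      (fun N => series (mehler_term k r x y) N * (f y * W y)).
    by apply/funext => N; rewrite /series/= mulr_suml.
  by apply: cvgMl; exact: mehlerE.
- move=> N y _; rewrite {1}/series/= -mulr_suml -/(series (mehler_term k r x y) N).
  rewrite normrM normrM (ger0_norm (weight_ge0 _ _)) [leRHS]mulrA.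
  rewrite ler_wpM2r ?mulr_ge0 ?weight_ge0//.
  apply: le_trans (mehler_norm_series_le k0 r0 r1 x y N).
  exact: ler_norm_series.
split => //; suff <- : (fun n => \int[mu]_y (mehler_term k r x y n * (f y * W y))) =
  (fun n => r ^+ n * dunkl_hermite k n x * dunkl_hermite_coef k f n) by [].
apply/funext => n; rewrite /dunkl_hermite_coef -RintegralZl//; last exact: integrable_coef_integrand.
by apply: eq_Rintegral => y _; exact: mehler_termM.
Qed.

Local Notation J x := (\int[mu]_y (mehler k r x y * (`|f y| `^ p * W y))%:E)%E.

Let J_ge0 x : (0 <= J x)%E.
Proof.
by apply: integral_ge0 => y _; rewrite lee_fin.
Qed.

(** Jensen's inequality for the kernel, whose rows have mass at most [M]: the
    tangent is taken at the value [|P f (x)| / M] that has to be bounded. *)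
Lemma mehler_transform_powR x :
  ((`|mehler_transform x| `^ p)%:E <= (M `^ (p - 1))%:E * J x)%E.
Proof.
have M0 : 0 < M by exact: mehler_mass_gt0.
set v := `|_|.
have [->|vn0] := eqVneq v 0.
  by rewrite powR0 ?gt_eqF// mule_ge0// ?lee_fin ?powR_ge0.
have v0 : 0 < v by rewrite lt_neqAle eq_sym vn0 normr_ge0.
pose a := v / M; have a0 : 0 < a by rewrite divr_gt0.
pose al := a `^ (1 - p) / p; pose be := a * (1 - p^-1).
have al0 : 0 <= al by rewrite divr_ge0 ?powR_ge0// ltW.
have be0 : 0 <= be by rewrite mulr_ge0 ?(ltW a0)// subr_ge0 invf_le1.
have h : (v%:E <= al%:E * J x + (be * M)%:E)%E.
  have [iG _] := mehler_transformE x.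
  apply: (@le_trans _ _ (\int[mu]_y (mehler k r x y * (`|f y| * W y))%:E)%E).
    rewrite /v /mehler_transform EFin_normr_Rintegral//.
    apply: (le_trans (le_abse_integral _ _ _)) => //.
      by case/integrableP : iG.
    apply: ge0_le_integral => //=.
    - by apply/measurable_EFinP; apply: measurableT_comp => //; exact: mKf.
    - by apply/measurable_EFinP; exact: mKaf.
    - by move=> y _; rewrite lee_fin normKf.
  apply: (@le_trans _ _ (\int[mu]_y (al%:E * (mehler k r x y * (`|f y| `^ p * W y))%:E +
     be%:E * (mehler k r x y * W y)%:E))%E).
    apply: ge0_le_integral => //=.
    - by move=> y _; rewrite lee_fin mulr_ge0// mulr_ge0.
    - by apply/measurable_EFinP; exact: mKaf.
    - by apply: emeasurable_funD; apply: measurable_funeM; apply/measurable_EFinP;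
        [exact: mKfp|exact: mKW].
    - move=> y _; rewrite -!EFinM -EFinD lee_fin.
      have -> : al * (mehler k r x y * (`|f y| `^ p * W y)) + be * (mehler k r x y * W y) =
        mehler k r x y * ((al * `|f y| `^ p + be) * W y) by ring.
      rewrite ler_wpM2l ?mehler_ge0// ler_wpM2r ?weight_ge0//.
      exact: le_powR_tangent.
  rewrite ge0_integralD//=; last 4 first.
  - by move=> y _; rewrite -EFinM lee_fin mulr_ge0.
  - by apply: measurable_funeM; apply/measurable_EFinP; exact: mKfp.
  - by move=> y _; rewrite -EFinM lee_fin mulr_ge0.
  - by apply: measurable_funeM; apply/measurable_EFinP; exact: mKW.
  rewrite !ge0_integralZl_EFin//=; last 4 first.
  - by move=> y _; rewrite lee_fin.
  - by apply/measurable_EFinP; exact: mKW.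
  - by move=> y _; rewrite lee_fin.
  - by apply/measurable_EFinP; exact: mKfp.
  rewrite leeD2l// (EFinM be M) lee_wpmul2l ?lee_fin//.
  exact: mehler_row_le.
case: (J x) (J_ge0 x) h => [j j0 h|_ _|//]; last first.
  by rewrite gt0_muley ?leey// lte_fin powR_gt0.
move: h; rewrite -EFinM -EFinD lee_fin -EFinM lee_fin => h.
have {h} : v / p <= al * j.
  have e : be * M = v - v / p by rewrite /be /a; field; rewrite !gt_eqF.
  by move: h; rewrite e; lra.
rewrite /al mulrAC ler_pM2r ?invr_gt0// /a powRM ?(ltW v0) ?invr_ge0 ?(ltW M0)// => h.
have -> : v `^ p = v `^ (p - 1) * v.
  by rewrite -[X in _ * X](powRr1 (ltW v0)) -(powRD_gt0 _ _ v0) subrK.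
apply: le_trans (ler_wpM2l (powR_ge0 _ _) h) _.
rewrite !mulrA -powRD_gt0// addrC subrKA subrr powRr0 mul1r.
by rewrite (powR_inv _ M0) opprB.
Qed.

(** Tonelli's theorem; the symmetry of the kernel turns column masses into row
    masses. *)
Lemma mehler_transform_Lp :
  (\int[mu]_x (J x * (W x)%:E) <= M%:E * Np)%E.
Proof.
pose h (z : R * R) : \bar R := (mehler k r z.1 z.2 * (`|f z.2| `^ p * W z.2) * W z.1)%:E.
have h0 z : (0 <= h z)%E.
  by rewrite lee_fin mulr_ge0.
have mh : measurable_fun [set: R * R] h.
  apply/measurable_EFinP; apply: measurable_funM; last exact: measurableT_comp.
  apply: measurable_funM => //; apply: measurable_funM.
    exact: (measurableT_comp mfp).
  exact: measurableT_comp.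
have -> : (\int[mu]_x (J x * (W x)%:E) = \int[mu]_x \int[mu]_y h (x, y))%E.
  apply: eq_integral => x _; rewrite -ge0_integralZr//=.
  - by apply/measurable_EFinP; exact: mKfp.
  - by move=> y _; rewrite lee_fin.
  - by rewrite lee_fin weight_ge0.
rewrite fubini_tonelli//.
rewrite -ge0_integralZl_EFin//=; last 3 first.
- by move=> y _; rewrite lee_fin.
- by apply/measurable_EFinP; exact: mfW.
- exact/ltW/mehler_mass_gt0.
apply: ge0_le_integral => //=.
- by move=> y _; exact: integral_ge0.
- exact: measurable_fun_fubini_tonelli_G.
- by apply: measurable_funeM; apply/measurable_EFinP; exact: mfW.
- move=> y _.
  have -> : (\int[mu]_x h (x, y) = (`|f y| `^ p * W y)%:E * \int[mu]_x (mehler k r y x * W x)%:E)%E.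
    rewrite -ge0_integralZl_EFin//=.
    + by apply: eq_integral => x _; rewrite /h -EFinM mehlerC; congr EFin => /=; ring.
    + by move=> x _; rewrite lee_fin.
    + by apply/measurable_EFinP; exact: mKW.
  rewrite muleC lee_wpmul2r ?lee_fin//.
  exact: mehler_row_le.
Qed.

Lemma measurable_mehler_transform : measurable_fun [set: R] mehler_transform.
Proof.
apply: (@measurable_fun_cvg _ _ _ _ (fun N x => series (fun n =>
  r ^+ n * dunkl_hermite k n x * dunkl_hermite_coef k f n) N)) => //.
  move=> N; apply: measurable_sum => n.
  by apply: measurable_funM => //; apply: measurable_funM => //; exact: measurable_dunkl_hermite.
by move=> x _; have [_] := mehler_transformE x.
Qed.

Lemma mehler_transform_le :
  (\int[mu]_x (`|mehler_transform x| `^ p * W x)%:E <= (M `^ p)%:E * Np)%E.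
Proof.
have M0 : 0 < M by exact: mehler_mass_gt0.
have mJ : measurable_fun [set: R] (fun x => J x).
  pose g (z : R * R) : \bar R := (mehler k r z.1 z.2 * (`|f z.2| `^ p * W z.2))%:E.
  have g0 z : (0 <= g z)%E by rewrite lee_fin.
  apply: (@measurable_fun_fubini_tonelli_F _ _ _ _ R mu g) => //.
  apply/measurable_EFinP; apply: measurable_funM => //; apply: measurable_funM.
    exact: (measurableT_comp mfp).
  exact: measurableT_comp.
have mP : measurable_fun [set: R] (fun x => `|mehler_transform x| `^ p).
  apply: (@measurableT_comp _ _ _ _ _ _ (fun z : R => z `^ p)); first exact: measurable_powR.
  by apply: measurableT_comp => //; exact: measurable_mehler_transform.
apply: (@le_trans _ _ (\int[mu]_x ((M `^ (p - 1))%:E * (J x * (W x)%:E)))%E).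
  apply: ge0_le_integral => //=.
  - by move=> x _; rewrite lee_fin mulr_ge0 ?powR_ge0.
  - by apply/measurable_EFinP; exact: measurable_funM.
  - by apply: measurable_funeM; apply: emeasurable_funM => //; apply/measurable_EFinP.
  - move=> x _; rewrite EFinM muleA lee_wpmul2r ?lee_fin//.
    exact: mehler_transform_powR.
rewrite ge0_integralZl_EFin//=; last 3 first.
- by move=> x _; rewrite mule_ge0 ?lee_fin.
- by apply: emeasurable_funM => //; apply/measurable_EFinP.
- exact: powR_ge0.
apply: (@le_trans _ _ ((M `^ (p - 1))%:E * (M%:E * Np))%E).
  by rewrite lee_wpmul2l ?lee_fin ?powR_ge0//; exact: mehler_transform_Lp.
rewrite muleA -EFinM -[X in _ * X](powRr1 (ltW M0)) -(powRD_gt0 _ _ M0) subrK.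
exact: lexx.
Qed.

End FixedR.

End Contraction.

(** * The heat-diffusion integral *)

Lemma Lp_norm_scale_le (R : realType) (k p c M : R) (f g : R -> R) : 0 <= k -> 0 < p ->
  0 <= c -> 0 <= M -> measurable_fun [set: R] g ->
  (\int[@lebesgue_measure R]_x (`|g x| `^ p * weight k x)%:E <=
   (M `^ p)%:E * \int[@lebesgue_measure R]_x (`|f x| `^ p * weight k x)%:E)%E ->
  (Lp_norm k p (fun x => (c * g x)%R) <= (c * M)%:E * Lp_norm k p f)%E.
Proof.
move=> k0 p0 c0 M0 mg gf.
have i0 (h : R -> R) : (0 <= \int[@lebesgue_measure R]_x (`|h x| `^ p * weight k x)%:E)%E.
  by apply: integral_ge0 => x _; rewrite lee_fin mulr_ge0 ?powR_ge0.
have mgw : measurable_fun [set: R] (fun x => `|g x| `^ p * weight k x).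
  apply: measurable_funM.
    apply: (@measurableT_comp _ _ _ _ _ _ (fun z : R => z `^ p)); first exact: measurable_powR.
    exact: measurableT_comp.
  exact: measurable_weight.
have -> : Lp_norm k p (fun x => c * g x) =
    (((c `^ p)%:E * \int[@lebesgue_measure R]_x (`|g x| `^ p * weight k x)%:E) `^ p^-1)%E.
  rewrite /Lp_norm -ge0_integralZl_EFin//=.
  - congr (_ `^ _)%E; apply: eq_integral => x _.
    by rewrite normrM (ger0_norm c0) powRM// -EFinM mulrA.
  - by move=> x _; rewrite lee_fin mulr_ge0 ?powR_ge0.
  - exact/measurable_EFinP.
  - exact: powR_ge0.
apply: (@le_trans _ _ ((((c * M) `^ p)%:E *
    \int[@lebesgue_measure R]_x (`|f x| `^ p * weight k x)%:E) `^ p^-1)%E).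
  apply: gt0_ler_poweR.
  - by rewrite invr_ge0 ltW.
  - by rewrite in_itv/= leey andbT; apply: mule_ge0; rewrite // lee_fin powR_ge0.
  - by rewrite in_itv/= leey andbT; apply: mule_ge0; rewrite // lee_fin powR_ge0.
  - rewrite (powRM _ c0 M0) EFinM -muleA; apply: lee_wpmul2l => //.
    by rewrite lee_fin powR_ge0.
rewrite poweRM ?lee_fin ?powR_ge0// poweR_EFin -powRrM divff ?gt_eqF//.
by rewrite powRr1// mulr_ge0.
Qed.

Section Heat.
Context {R : realType}.
Variables (k p : R) (f : R -> R) (t : R).
Hypotheses (k0 : 0 <= k) (p1 : 1 <= p) (fp : in_Lp k p f) (t0 : 0 < t).

Notation mu := (@lebesgue_measure R).
Local Notation b := (k + 1 / 2).
Local Notation r := (expR (- (2 * t))).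

Let r0 : 0 < r. Proof. exact: expR_gt0. Qed.
Let r1 : r < 1. Proof. by rewrite expR_lt1 oppr_lt0 mulr_gt0. Qed.
Let p0 : 0 < p. Proof. exact: lt_le_trans p1. Qed.

Lemma heat_termE x n : heat_term k f t x n =
  expR (- (t * (2 * k + 1))) * (r ^+ n * dunkl_hermite k n x * dunkl_hermite_coef k f n).
Proof.
rewrite /heat_term -expRM_natl.
have -> : - t * (2 * n%:R + 2 * k + 1) = - (t * (2 * k + 1)) + n%:R * - (2 * t) by ring.
by rewrite expRD; ring.
Qed.

Lemma heat_diffusion_cvg x : series (heat_term k f t x) @ \oo -->
  expR (- (t * (2 * k + 1))) * mehler_transform k f r x.
Proof.
rewrite (funext (heat_termE x)); apply: cvg_seriesMl.
by have [_] := mehler_transformE k0 p1 fp r0 r1 x.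
Qed.

Lemma heat_diffusionE x :
  heat_diffusion k f t x = expR (- (t * (2 * k + 1))) * mehler_transform k f r x.
Proof. by apply/cvg_lim => //; exact: heat_diffusion_cvg. Qed.

(** With [r = expR (- 2 t)], [(1 + r^2) / 2 = r cosh (2 t)]; the power of [r]
    is compensated by the shift of the spectrum by [2 k + 1]. *)
Lemma heat_mass : expR (- (t * (2 * k + 1))) * mehler_mass k r = cosh (2 * t) `^ (- b).
Proof.
rewrite /mehler_mass.
have -> : (1 + r ^+ 2) / 2 = r * cosh (2 * t).
  rewrite /cosh mulrA; congr (_ / _).
  by rewrite mulrDr -expRD addNr expR0 expr2.
have c0 : 0 < cosh (2 * t) by rewrite divr_gt0// addr_gt0 ?expR_gt0.
rewrite powRM ?(ltW r0) ?(ltW c0)// mulrA -expRM -expRD.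
have -> : - (t * (2 * k + 1)) + - (2 * t) * - b = 0 by field.
by rewrite expR0 mul1r.
Qed.

Lemma measurable_heat_diffusion : measurable_fun [set: R] (heat_diffusion k f t).
Proof.
rewrite (funext heat_diffusionE); apply: measurable_funM => //.
exact: (measurable_mehler_transform k0 p1 fp r0 r1).
Qed.

Lemma Lp_norm_heat_diffusion_le :
  (Lp_norm k p (heat_diffusion k f t) <= (cosh (2 * t) `^ (- b))%:E * Lp_norm k p f)%E.
Proof.
rewrite -heat_mass (funext heat_diffusionE); apply: Lp_norm_scale_le => //.
- exact/ltW/mehler_mass_gt0.
- exact: (measurable_mehler_transform k0 p1 fp r0 r1).
- exact: (mehler_transform_le k0 p1 fp r0 r1).
Qed.

End Heat.

Unset Implicit Arguments.
Set Strict Implicit.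
Set Printing Implicit Defensive.

(* MathComp-Analysis world. The first two conjuncts say that the coefficients
   and the series defining the heat-diffusion integral are well defined. *)
Theorem theorem1 (R : realType) (k p : R) (f : R -> R)
    (hk : 0 <= k) (hp : 1 <= p) (hf : in_Lp k p f) (t : R) (ht : 0 < t) :
  (forall n : nat,
     lebesgue_measure.-integrable setT (EFin \o coef_integrand k f n)) /\
  (forall x : R, cvgn (series (heat_term k f t x))) /\
  in_Lp k p (heat_diffusion k f t) /\
  (Lp_norm k p (heat_diffusion k f t)
     <= (cosh (2 * t) `^ (- (k + 1 / 2)))%:E * Lp_norm k p f)%E.
Proof.
have r0 : 0 < expR (- (2 * t)) by exact: expR_gt0.
have r1 : expR (- (2 * t)) < 1 by rewrite expR_lt1 oppr_lt0 mulr_gt0.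
have hle := Lp_norm_heat_diffusion_le hk hp hf ht.
split; first by move=> n; exact: (integrable_coef_integrand hk hp hf r0 r1).
split; first by move=> x; apply/cvg_ex; eexists; exact: (heat_diffusion_cvg hk hp hf ht).
split; last exact: hle.
split; first exact: (measurable_heat_diffusion hk hp hf ht).
apply: le_lt_trans hle _; apply: lte_mul_pinfty; rewrite ?lee_fin ?powR_ge0//.
by case: hf.
Qed.
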